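(* Let $\alpha\in\mathbb{N}$ and $\rho\in\mathcal{S}_+^{\rm mon}$. There is a constant $C_{\rho,\alpha}>0$ such that for all $f\in W^{\alpha,2}_{\rho}(\mathbb{R})$ and all $n\in\mathbb{N}$, $$\big|I_\rho(f)-Q_{\rho,n}(f)\big|\le C_{\rho,\alpha}\, n^{-\alpha}\,\|f\|_{W^{\alpha,2}_{\rho}(\mathbb{R})}.$$ In particular, $C_{\rho,\alpha}$ is independent of $f$ and $n$.
   Context: $\mathbb{N}=\{1,2,\dots\}$, $\mathbb{N}_0=\mathbb{N}\cup\{0\}$. Monotonic Schwartz weights: $\mathcal{S}$ is the Schwartz space of $\omega\in C^\infty(\mathbb{R})$ with $\sup_{x\in\mathbb{R}}|x^a\omega^{(b)}(x)|<\infty$ for all $a,b\in\mathbb{N}_0$. $\mathcal{S}_+^{\rm mon}$ is the set of real-valued $\omega\in\mathcal{S}$ with $\omega(x)>0$ for all $x\in\mathbb{R}$ for which there exists $K>0$ such that $x\,\omega'(x)\le 0$ for all $x\in\mathbb{R}\setminus[-K,K]$. Weighted Sobolev space: for $1<q<\infty$, $\alpha\in\mathbb{N}$, $W^{\alpha,q}_\rho(\mathbb{R})$ is the space of functions $f:\mathbb{R}\to\mathbb{C}$ with weak derivatives $f^{(\tau)}$, $\tau=0,\dots,\alpha$, and $\|f\|_{W^{\alpha,q}_\rho(\mathbb{R})}=\big(\sum_{\tau=0}^\alpha\int_{\mathbb{R}}|f^{(\tau)}(x)|^q\rho(x)\,dx\big)^{1/q}<\infty$. The continuous representative of $f$ is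 always used. Möbius transformation: fix $c>0$ (constants may depend on $c$) and let $\phi:(0,2\pi)\to\mathbb{R}$, $\phi(\theta)=-c\cot(\theta/2)$, so $\phi'(\theta)=\frac{c}{2\sin^2(\theta/2)}$. Integral and quadrature: $I_\rho(f)=\int_{\mathbb{R}}f(x)\rho(x)\,dx$ and, with $\theta_j=2\pi j/n$, $$Q_{\rho,n}(f)=\frac{2\pi}{n}\sum_{j=1}^n f(\phi(\theta_j))\,\rho(\phi(\theta_j))\,\phi'(\theta_j),$$ where the summand at $\theta_n=2\pi$ is understood as its limit value, namely $0$. *)

(* Defs.v *)
From HB Require Import structures.
From mathcomp Require Import all_boot all_order all_algebra.
From mathcomp Require Import all_classical all_reals all_analysis.
From mathcomp Require Import complex.

Set Implicit Arguments.
Unset Strict Implicit.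
Unset Printing Implicit Defensive.

Import Order.TTheory GRing.Theory Num.Theory.
Import numFieldNormedType.Exports.

Local Open Scope classical_set_scope.
Local Open Scope ring_scope.
Local Open Scope complex_scope.

Definition smooth (R : realType) (f : R -> R) : Prop :=
  forall (k : nat) (x : R), derivable (derive1n k f) x 1.

Definition schwartz (R : realType) (w : R -> R) : Prop :=
  smooth w /\
  forall a b : nat, has_ubound (range (fun x : R => `|x ^+ a * derive1n b w x|)).

Definition schwartz_mon (R : realType) (w : R -> R) : Prop :=
  [/\ schwartz w,
      forall x : R, 0 < w x &
      exists K : R, 0 < K /\
        forall x : R, x \notin `[- K, K] -> x * derive1 w x <= 0].

Definition test_function (R : realType) (psi : R -> R) : Prop :=
  smooth psi /\ compact (closure [set x : R | psi x != 0]).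

(* Lebesgue integral over the real line of a complex-valued function,
   taken componentwise. *)
Definition cintegral (R : realType) (f : R -> R[i]) : R[i] :=
  Complex (Rintegral (@lebesgue_measure R) setT (fun x => complex.Re (f x)))
          (Rintegral (@lebesgue_measure R) setT (fun x => complex.Im (f x))).

Definition clocally_integrable (R : realType) (f : R -> R[i]) : Prop :=
  locally_integrable [set: R] (fun x => complex.Re (f x)) /\
  locally_integrable [set: R] (fun x => complex.Im (f x)).

(* Testing against real psi is enough, since complex test functions are
   complex combinations of real ones. *)
Definition is_weak_deriv (R : realType) (tau : nat) (f g : R -> R[i]) : Prop :=
  [/\ clocally_integrable f,
      clocally_integrable g &
      forall psi : R -> R, test_function psi ->
        cintegral (fun x => f x * (derive1n tau psi x)%:C) =
        (-1) ^+ tau * cintegral (fun x => g x * (psi x)%:C)].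

(* Weak derivatives are unique up to null sets, so the representative chosen
   by xget has no influence on the norm below. *)
Definition weak_deriv (R : realType) (f : R -> R[i]) (tau : nat) : R -> R[i] :=
  if tau is 0%N then f
  else xget (fun _ : R => 0 : R[i]) [set g | is_weak_deriv tau f g].

(* Extended-real valued. The modulus is Normc.normc, because the generic norm
   on R[i] takes its values in R[i]. *)
Definition sobolev_norm (R : realType) (alpha : nat) (q : R) (rho : R -> R)
    (f : R -> R[i]) : \bar R :=
  ((\sum_(0 <= tau < alpha.+1)
     \int[@lebesgue_measure R]_(x in setT)
       (powR (Normc.normc (weak_deriv f tau x)) q * rho x)%:E) `^ q^-1)%E.

Definition sobolev (R : realType) (alpha : nat) (q : R) (rho : R -> R)
    (f : R -> R[i]) : Prop :=
  (forall tau : nat, (tau <= alpha)%N -> exists g, is_weak_deriv tau f g) /\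
  (sobolev_norm alpha q rho f < +oo)%E.

Definition mobius (R : realType) (c theta : R) : R :=
  - c * (cos (theta / 2) / sin (theta / 2)).

Definition mobius' (R : realType) (c theta : R) : R :=
  c / (2 * sin (theta / 2) ^+ 2).

Definition weighted_integral (R : realType) (rho : R -> R) (f : R -> R[i])
    : R[i] :=
  cintegral (fun x => f x * (rho x)%:C).

Definition node (R : realType) (n j : nat) : R := 2 * pi * j%:R / n%:R.

(* The last node is 2 * pi, outside the domain of the change of variables: its
   summand is the limit value 0. *)
Definition quadrature (R : realType) (c : R) (rho : R -> R) (n : nat)
    (f : R -> R[i]) : R[i] :=
  (2 * pi / n%:R)%:C *
  \sum_(1 <= j < n.+1)
    (if j == n then 0
     else f (mobius c (node R n j)) *
          (rho (mobius c (node R n j)) * mobius' c (node R n j))%:C).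

(* Main.v *)
Require Import Defs.
From HB Require Import structures.
From mathcomp Require Import all_boot all_order all_algebra.
From mathcomp Require Import all_classical all_reals all_analysis.
From mathcomp Require Import complex.
From mathcomp Require Import measurable_realfun zify ring lra.

Set Implicit Arguments.
Unset Strict Implicit.
Unset Printing Implicit Defensive.

Import Order.TTheory GRing.Theory Num.Theory.
Import numFieldNormedType.Exports.

Local Open Scope classical_set_scope.
Local Open Scope ring_scope.

(** Let angle c x = pi + 2 atan (x / c) be the inverse of the Moebius map, jac its
    Jacobian in the variable x, and L = jac d/dx the derivative along the circle.
    The quadrature rule pairs f rho with point masses at the angles 2 pi j / n,
    and on the circle the constant 1 minus these masses is n ^- alpha times the
    alpha-th derivative of a bounded periodic function evaluated at n theta. So
    the error is n ^- alpha times the integral of f rho L^alpha (k) with k bounded.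
    Integration by parts moves the derivatives to f and rho, and what is left are
    weak derivatives of f of order at most alpha against derivatives of rho
    multiplied by polynomials. Cauchy-Schwarz then gives the Sobolev norm of f.

    Two points need care. First, the weak derivatives are only known through test
    functions. Therefore the point masses are replaced by the Fejer kernel and rho
    by rho times a smooth cutoff: then k is the trigonometric polynomial pkernel,
    and the integration by parts (pairing_bound) is a pointwise identity between
    test functions. Every constant is uniform in the order M of the Fejer kernel
    and in the cutoff. For k this is kernel_bounded, where positivity of the
    Fejer kernel gives the case alpha = 1. Both regularisations are removed in the
    end, by fejer_limit for the nodes and by dominated convergence for the cutoff
    (real_quadrature_error).

    Second, Cauchy-Schwarz with the weight rho needs (x^m rho^(i)(x))^2 / rho(x) to
    be integrable for all i and m, which is false for general positive Schwartz
    functions. Here monotonicity enters (schwartz_mon_derive_le): on the tail the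
    supremum of rho over [x, oo) is rho(x), and the Landau-Kolmogorov inequality
    between rho and a derivative of high order bounds rho^(i)(x) by a power of
    rho(x) as close to 1 as needed, in particular by sqrt (rho(x)) with any
    polynomial decay to spare. *)

(** * Calculus of smooth functions *)

Section Smooth.
Variable R : realType.
Implicit Types (f g : R -> R) (x : R).

Lemma is_derive1 f (x d : R) : is_derive x 1 f d -> derivable f x 1 /\ derive1 f x = d.
Proof. by move=> [h1 h2]; rewrite derive1E. Qed.

Lemma derive1_ext f (d : R -> R) :
  (forall x, is_derive x 1 f (d x)) -> derive1 f = d.
Proof. by move=> h; apply/funext => x; have [] := is_derive1 (h x). Qed.

(** Unlike smooth, this is indexed by the number of derivatives and peels them
    off from the inside, which makes the product, chain and quotient rules
    provable by induction on k. *)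
Fixpoint Cn (k : nat) (f : R -> R) : Prop :=
  if k is k'.+1 then (forall x, derivable f x 1) /\ Cn k' (derive1 f) else True.

Lemma smoothP f : smooth f <-> (forall k, Cn k f).
Proof.
split=> [h k|].
  elim: k f h => [//|k IH] f h; split; first exact: (h 0%N).
  by apply: IH => i x; rewrite -derive1Sn; exact: h.
move=> h k; elim: k f h => [|k IH] f h x; first by have [] := h 1%N.
by rewrite derive1Sn; apply: IH => j; have [] := h j.+1.
Qed.

Lemma smooth_derivable f x : smooth f -> derivable f x 1.
Proof. by move=> /(_ 0%N); exact. Qed.

Lemma smooth_derive1 f : smooth f -> smooth (derive1 f).
Proof. by move=> h k x; rewrite -derive1Sn; exact: h. Qed.

Lemma smooth_derive1n k f : smooth f -> smooth (derive1n k f).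
Proof.
elim: k f => [//|k IH] f h; rewrite derive1nS; exact/smooth_derive1/IH.
Qed.

Lemma smooth_is_derive f x : smooth f -> is_derive x 1 f (derive1 f x).
Proof. by move=> h; rewrite derive1E; apply/derivableP/smooth_derivable. Qed.

Lemma smooth_continuous f : smooth f -> continuous f.
Proof.
by move=> h x; apply/differentiable_continuous/derivable1_diffP/smooth_derivable.
Qed.

Lemma CnS k f : Cn k.+1 f -> Cn k f.
Proof. by elim: k f => [//|k IH] f [h1 h2]; split=> //; exact: IH. Qed.

Lemma Cn_cst k (a : R) : Cn k (fun _ : R => a).
Proof.
elim: k a => [//|k IH] a; split; first by move=> x; exact: derivable_cst.
by rewrite (@derive1_ext _ (fun=> 0)).
Qed.

Lemma Cn_id k : Cn k (fun x : R => x).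
Proof.
case: k => [//|k]; split; first by move=> x; exact: derivable_id.
by rewrite (@derive1_ext _ (fun=> 1)); first exact: Cn_cst.
Qed.

Lemma derive1_add f g : (forall x, derivable f x 1) -> (forall x, derivable g x 1) ->
  derive1 (fun x => f x + g x) = fun x => derive1 f x + derive1 g x.
Proof.
move=> hf hg; apply: derive1_ext => x; rewrite !derive1E.
by apply: is_deriveD; exact/derivableP.
Qed.

Lemma derive1_mul f g : (forall x, derivable f x 1) -> (forall x, derivable g x 1) ->
  derive1 (fun x => f x * g x) = fun x => derive1 f x * g x + f x * derive1 g x.
Proof.
move=> hf hg; apply: derive1_ext => x; rewrite !derive1E.
have h := @is_deriveM _ _ f g x 1 _ _ (derivableP (hf x)) (derivableP (hg x)).
by apply: is_derive_eq h _; rewrite /GRing.scale/= addrC mulrC.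
Qed.

Lemma derivable_mul f g x : derivable f x 1 -> derivable g x 1 ->
  derivable (fun x => f x * g x) x 1.
Proof. by move=> hf hg; exact: (derivableM hf hg). Qed.

Lemma Cn_add k f g : Cn k f -> Cn k g -> Cn k (fun x => f x + g x).
Proof.
elim: k f g => [//|k IH] f g [f1 f2] [g1 g2]; split.
  by move=> x; exact: (@derivableD _ _ _ f g).
by rewrite derive1_add//; exact: IH.
Qed.

Lemma Cn_mul k f g : Cn k f -> Cn k g -> Cn k (fun x => f x * g x).
Proof.
elim: k f g => [//|k IH] f g hf hg.
have [f1 f2] := hf; have [g1 g2] := hg; split.
  by move=> x; exact: derivable_mul.
by rewrite derive1_mul//; apply: Cn_add; apply: IH => //; exact: CnS.
Qed.

Lemma derive1_compE f g : (forall x, derivable f x 1) -> (forall x, derivable g x 1) ->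
  derive1 (fun x => f (g x)) = fun x => derive1 f (g x) * derive1 g x.
Proof. by move=> hf hg; apply/funext => x; rewrite (@derive1_comp _ g f)//. Qed.

Lemma derivable_compE f g x : derivable g x 1 -> derivable f (g x) 1 ->
  derivable (fun x => f (g x)) x 1.
Proof.
move=> /derivable1_diffP hg /derivable1_diffP hf; apply/derivable1_diffP.
exact: (@differentiable_comp _ _ _ _ g f).
Qed.

Lemma Cn_comp k f g : Cn k f -> Cn k g -> Cn k (fun x => f (g x)).
Proof.
elim: k f g => [//|k IH] f g [f1 f2] hg; have [g1 g2] := hg; split.
  by move=> x; exact: derivable_compE.
by rewrite derive1_compE//; apply: Cn_mul => //; apply: IH => //; exact: CnS.
Qed.

Lemma Cn_inv k f : (forall x, f x != 0) -> Cn k f -> Cn k (fun x => (f x)^-1).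
Proof.
move=> f0; elim: k => [//|k IH] hf; have [f1 f2] := hf.
have kf := IH (CnS hf); split; first by move=> x; exact: (@derivableV _ _ f).
rewrite (_ : derive1 _ = fun x => (-1) * (((f x)^-1 * (f x)^-1) * derive1 f x)).
  by apply: Cn_mul; [exact: Cn_cst|apply: Cn_mul => //; exact: Cn_mul].
apply/funext => x; rewrite derive1E (@deriveV _ _ f)// -derive1E /GRing.scale/=.
by rewrite mulN1r mulNr -exprVn expr2.
Qed.

Lemma smooth_cst (a : R) : smooth (fun _ : R => a).
Proof. by apply/smoothP => k; exact: Cn_cst. Qed.
Lemma smooth_id : smooth (fun x : R => x).
Proof. by apply/smoothP => k; exact: Cn_id. Qed.
Lemma smooth_add f g : smooth f -> smooth g -> smooth (fun x => f x + g x).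
Proof. by move=> /smoothP hf /smoothP hg; apply/smoothP => k; exact: Cn_add. Qed.
Lemma smooth_mul f g : smooth f -> smooth g -> smooth (fun x => f x * g x).
Proof. by move=> /smoothP hf /smoothP hg; apply/smoothP => k; exact: Cn_mul. Qed.
Lemma smooth_comp f g : smooth f -> smooth g -> smooth (fun x => f (g x)).
Proof. by move=> /smoothP hf /smoothP hg; apply/smoothP => k; exact: Cn_comp. Qed.
Lemma smooth_inv f : (forall x, f x != 0) -> smooth f -> smooth (fun x => (f x)^-1).
Proof. by move=> f0 /smoothP hf; apply/smoothP => k; exact: Cn_inv. Qed.
Lemma smooth_opp f : smooth f -> smooth (fun x => - f x).
Proof.
move=> hf; rewrite (_ : (fun x => - f x) = fun x => (-1) * f x).
  exact: (smooth_mul (@smooth_cst (-1)) hf).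
by apply/funext => x; rewrite mulN1r.
Qed.

Lemma smooth_sum (I : Type) (r : seq I) (F : I -> R -> R) :
  (forall i, smooth (F i)) -> smooth (fun x => \sum_(i <- r) F i x).
Proof.
move=> h; elim: r => [|i r IH].
  rewrite (_ : (fun x => _) = fun=> 0); first exact: smooth_cst.
  by apply/funext => x; rewrite big_nil.
rewrite (_ : (fun x => _) = fun x => F i x + \sum_(j <- r) F j x).
  exact: (smooth_add (h i) IH).
by apply/funext => x; rewrite big_cons.
Qed.

(** Handles functions such as the arctangent whose derivative, but not the
    function itself, is an elementary combination of smooth functions. *)
Lemma smooth_antiderivative f d : (forall x, is_derive x 1 f (d x)) ->
  smooth d -> smooth f.
Proof.
move=> fd /smoothP sd; apply/smoothP => -[//|k]; split.
  by move=> x; have [] := is_derive1 (fd x).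
by rewrite (derive1_ext fd).
Qed.

Lemma smooth_cos_sin : smooth (@cos R) /\ smooth (@sin R).
Proof.
suff h k : Cn k (@cos R) /\ Cn k (@sin R).
  by split; apply/smoothP => k; have [] := h k.
elim: k => [//|k [IH1 IH2]]; split; split.
- by move=> x; have [] := is_derive_cos x.
- rewrite (derive1_ext (@is_derive_cos R)).
  rewrite (_ : (fun x => _) = fun x => (-1) * sin x).
    by apply: Cn_mul => //; exact: Cn_cst.
  by apply/funext => x; rewrite mulN1r.
- by move=> x; have [] := is_derive_sin x.
- by rewrite (derive1_ext (@is_derive_sin R)).
Qed.

Lemma derive1n_add k f g : smooth f -> smooth g ->
  derive1n k (fun x => f x + g x) = fun x => derive1n k f x + derive1n k g x.
Proof.
elim: k f g => [//|k IH] f g hf hg; rewrite !derive1Sn derive1_add; last 2 first.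
- by move=> x; exact: smooth_derivable.
- by move=> x; exact: smooth_derivable.
by rewrite (IH _ _ (smooth_derive1 hf) (smooth_derive1 hg)).
Qed.

Lemma derive1n_scale k f (a : R) : smooth f ->
  derive1n k (fun x => a * f x) = fun x => a * derive1n k f x.
Proof.
elim: k f => [//|k IH] f hf; rewrite !derive1Sn derive1_mul; last 2 first.
- by move=> x; exact: derivable_cst.
- by move=> x; exact: smooth_derivable.
rewrite -(IH _ (smooth_derive1 hf)); congr (derive1n k _).
by apply/funext => x; rewrite derive1_cst mul0r add0r.
Qed.

Lemma derive1n_eq_near k f g x : (\forall y \near x, f y = g y) ->
  \forall y \near x, derive1n k f y = derive1n k g y.
Proof.
elim: k f g => [//|k IH] f g h; rewrite !derive1Sn; apply: IH.
move/near_join : h; apply: filterS => y hy.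
by rewrite !derive1E; exact: near_eq_derive.
Qed.

Lemma derive1n_cst k (r : R) x : derive1n k.+1 (fun=> r) x = 0.
Proof.
rewrite derive1Sn (@derive1_ext _ (fun=> 0)).
by elim: k x => [//|k IH] x; rewrite derive1Sn (@derive1_ext _ (fun=> 0)).
Qed.

Lemma derive1n_support k f (A : R) : (forall x, A < `|x| -> f x = 0) ->
  forall x, A < `|x| -> derive1n k f x = 0.
Proof.
move=> h x Ax.
have : \forall y \near x, derive1n k f y = derive1n k (fun=> 0) y.
  apply: derive1n_eq_near; near=> y; apply: h.
  near: y; have cn : continuous (fun y : R => `|y|) by exact: norm_continuous.
  exact: (cn x _ (lt_nbhsr Ax)).
by move=> /nbhs_singleton; case: k => [|k] ->; rewrite ?derive1n_cst.
Unshelve. all: by end_near. Qed.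

End Smooth.

(** * A smooth bump *)

Section Bump.
Variable R : realType.
Implicit Types (f g : R -> R) (x : R).

(** Settles the one delicate point, the derivative of flat at the origin. *)
Lemma is_derive_quadratic_zero f (C : R) :
  (forall x, `|f x| <= C * x ^+ 2) -> is_derive (0 : R) 1 f 0.
Proof.
move=> hC.
have f0 : f 0 = 0.
  by apply/eqP; rewrite -normr_le0 (le_trans (hC 0))// expr0n mulr0.
have C0 : 0 <= C by have := hC 1; rewrite expr1n mulr1; apply: le_trans.
suff cv : (fun h : R => h^-1 *: (f (h *: 1 + 0) - f 0)) @ 0^' --> (0 : R).
  by apply: DeriveDef; [apply/cvg_ex; exists 0|apply/cvg_lim].
apply/cvgrPdist_lt => e e0; near=> h.
rewrite sub0r normrN f0 subr0 addr0 /GRing.scale/= mulr1.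
have h0 : h != 0 by near: h; exact: nbhs_dnbhs_neq.
rewrite normrM normfV ltr_pdivrMl ?normr_gt0//.
apply: le_lt_trans (hC h) _.
rewrite -normr_id -[h ^+ 2]ger0_norm ?sqr_ge0// normrX expr2 mulrA mulrC.
rewrite normr_id ltr_pM2l ?normr_gt0//.
have : `|h| < e / (C + 1).
  near: h; apply: dnbhs0_lt; rewrite divr_gt0//; lra.
rewrite ltr_pdivlMr; last lra.
apply: le_lt_trans; rewrite mulrC ler_wpM2l//; lra.
Unshelve. all: by end_near. Qed.

(** The derivatives of exp (-1/x), extended by 0, are combinations of these. *)
Definition flat (m : nat) (x : R) : R :=
  if 0 < x then x ^- m * expR (- x^-1) else 0.

(** With z = 1 / x this is z ^ (m + 2) / (m + 2)! <= exp z. *)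
Lemma flat_le m x : `|flat m x| <= (m.+2)`!%:R * x ^+ 2.
Proof.
rewrite /flat; case: ifPn => x0; last first.
  by rewrite normr0 mulr_ge0// sqr_ge0.
have xV : 0 <= x^-1 by rewrite invr_ge0 ltW.
rewrite ger0_norm; last by rewrite mulr_ge0 ?invr_ge0 ?exprn_ge0 ?expR_ge0// ltW.
rewrite expRN ler_pdivrMr ?expR_gt0//.
have h := @expR_ge1Dxn R x^-1 m.+1 xV.
have : x^-1 ^+ m.+2 <= (m.+2)`!%:R * expR x^-1.
  rewrite mulrC -ler_pdivrMr ?ltr0n ?fact_gt0//; apply: le_trans h; lra.
move=> /(ler_wpM2l (sqr_ge0 x)).
rewrite exprVn.
have -> : x ^+ 2 * x ^- m.+2 = x ^- m.
  rewrite -[m.+2]addn2 (exprD x m 2) invfM mulrCA mulfV ?mulr1// expf_eq0/=.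
  by rewrite gt_eqF.
by rewrite mulrA [x ^+ 2 * _]mulrC.
Qed.

Lemma is_derive_flat m x :
  is_derive x 1 (flat m) (- m%:R * flat m.+1 x + flat m.+2 x).
Proof.
have [x0|x0|->] := ltrgt0P x; last 2 first.
- have e : flat m.+1 x = 0 /\ flat m.+2 x = 0 by rewrite /flat !ltNge (ltW x0).
  rewrite e.1 e.2 mulr0 addr0.
  apply: (@near_eq_is_derive _ _ _ (fun=> 0)).
    near=> y; rewrite /flat ltNge (_ : y <= 0)//.
    near: y; exact: lt_le_nbhsl.
- have e : flat m.+1 0 = 0 /\ flat m.+2 0 = 0 by rewrite /flat !ltxx.
  rewrite e.1 e.2 mulr0 addr0; exact: is_derive_quadratic_zero (flat_le m).
have hn : \forall y \near x, y^-1 ^+ m * expR (- y^-1) = flat m y.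
  near=> y; rewrite /flat (_ : 0 < y) ?exprVn//.
  near: y; exact: lt_nbhsr.
apply: (near_eq_is_derive hn).
have e k : flat k x = x^-1 ^+ k * expR (- x^-1) by rewrite /flat x0 exprVn.
rewrite !e.
have dV : is_derive x 1 (fun y : R => y^-1) (- x ^- 2).
  have h := @is_deriveV _ id x 1 1 (lt0r_neq0 x0) (is_derive_id x 1).
  by apply: is_derive_eq h _; rewrite /GRing.scale/= mulr1.
have dN : is_derive x 1 (fun y : R => - y^-1) (x ^- 2).
  by rewrite -[x ^- 2]opprK; exact: (@is_deriveN _ _ _ (fun y : R => y^-1)).
have dE : is_derive x 1 (fun y : R => expR (- y^-1)) (expR (- x^-1) * x ^- 2).
  have := @is_derive1_comp _ expR (fun y : R => - y^-1) x _ _ (is_derive_expR _) dN.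
  by rewrite mulrC.
have dX : is_derive x 1 (fun y : R => y^-1 ^+ m) (m%:R * x^-1 ^+ m.-1 * (- x ^- 2)).
  have := @is_deriveX _ _ (fun y : R => y^-1) m x 1 _ dV.
  rewrite exprfctE => h; apply: is_derive_eq h _.
  by rewrite /GRing.scale/=.
have h := @is_deriveM _ _ _ _ _ _ _ _ dX dE.
apply: is_derive_eq h _.
rewrite /GRing.scale/= -!exprVn; set z := x^-1; set E := expR _.
case: m {dX hn} => [|m] /=; first by rewrite !mul0r oppr0 expr0; ring.
rewrite !exprS; ring.
Unshelve. all: by end_near. Qed.

Lemma smooth_flat m : smooth (flat m).
Proof.
apply/smoothP => k; elim: k m => [//|k IH] m; split.
  by move=> x; have [] := is_derive1 (is_derive_flat m x).
rewrite (derive1_ext (is_derive_flat m)).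
apply: Cn_add => //; apply: Cn_mul => //; exact: Cn_cst.
Qed.

(** Normalised by chi 0 = 1, so that the dilates chi (x / N) tend to 1. *)
Definition chi x : R := expR 1 * flat 0 (1 - x * x).

Lemma smooth_chi : smooth chi.
Proof.
apply: smooth_mul; first exact: smooth_cst.
apply: (@smooth_comp _ (flat 0)); first exact: smooth_flat.
apply: smooth_add; first exact: smooth_cst.
apply/smooth_opp/smooth_mul; exact: smooth_id.
Qed.

Lemma chi0 : chi 0 = 1.
Proof. by rewrite /chi /flat mulr0 subr0 ltr01 invr1 mul1r expRxMexpNx_1. Qed.

Lemma chi_out x : 1 <= `|x| -> chi x = 0.
Proof.
move=> x1; rewrite /chi /flat ltNge (_ : 1 - x * x <= 0) ?mulr0//.
rewrite subr_le0 -expr2 -[x ^+ 2]ger0_norm ?sqr_ge0// normrX.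
by rewrite exprn_ege1.
Qed.

Lemma chi_itv x : 0 <= chi x <= 1.
Proof.
rewrite /chi /flat; case: ifPn => [h|_]; last by rewrite mulr0 lexx ler01.
rewrite expr0 invr1 mul1r mulr_ge0 ?expR_ge0//=.
rewrite -expRD expR_le1 subr_le0 -[leLHS]invr1 lef_pV2 ?posrE//.
by rewrite gerBl -expr2 sqr_ge0.
Qed.

Lemma derive1n_chi_bounded k : exists C, forall x, `|derive1n k chi x| <= C.
Proof.
have cf : {within `[-1, 1]%classic, continuous (fun x => `|derive1n k chi x|)}.
  apply: continuous_subspaceT => x.
  apply: (@continuous_comp _ _ _ (derive1n k chi) (fun y : R => `|y|)).
    exact/smooth_continuous/smooth_derive1n/smooth_chi.
  exact: norm_continuous.
have N11 : (-1 : R) <= 1 by lra.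
have [c _ hc] := EVT_max N11 cf.
exists `|derive1n k chi c| => x; have [x1|x1] := leP `|x| 1.
  by apply: hc; rewrite in_itv/= -ler_norml.
by rewrite (derive1n_support _ (fun y h => chi_out (ltW h)) x1) normr0.
Qed.

End Bump.

(** * Periodic Bernoulli-type kernels and the Fejer kernel *)

Section Kernel.
Variable R : realType.
Implicit Types (t : R) (j m p M : nat).

Definition mode j m t : R :=
  2 * m.+1%:R ^- j * cos (m.+1%:R * t - j%:R * (pi / 2)).

(** The Fejer mean of order M of the 2 pi-periodic function of mean 0 whose j-th
    derivative is 2 pi times the sum of the point masses at the multiples of
    2 pi, minus 1. *)
Definition pkernel j M t : R := M%:R^-1 * \sum_(p < M) \sum_(m < p) mode j m t.

Definition fejer M t : R := 1 + pkernel 0 M t.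

Lemma is_derive_affine (a b t : R) : is_derive t 1 (fun t => a * t + b) a.
Proof.
have h1 := @is_deriveM _ _ _ _ _ _ _ _ (is_derive_cst a t 1) (is_derive_id t 1).
have h := @is_deriveD _ _ _ _ _ _ _ _ _ h1 (is_derive_cst b t 1).
by apply: is_derive_eq h _; rewrite /GRing.scale/= mulr1 mulr0 !addr0.
Qed.

Lemma smooth_affine (a b : R) : smooth (fun t : R => a * t + b).
Proof.
apply: smooth_add; last exact: smooth_cst.
apply: smooth_mul; [exact: smooth_cst|exact: smooth_id].
Qed.

Lemma is_derive_mode j m t : is_derive t 1 (mode j.+1 m) (mode j m t).
Proof.
have h1 := is_derive_affine m.+1%:R (- (j.+1%:R * (pi / 2))) t.
have h2 := @is_derive1_comp _ (@cos R) _ t _ _ (is_derive_cos _) h1.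
have h := @is_deriveM _ _ _ _ _ _ _ _
  (is_derive_cst (2 * m.+1%:R ^- j.+1 : R) t 1) h2.
apply: is_derive_eq h _.
rewrite /GRing.scale/= mulr0 addr0 /mode.
set y := m.+1%:R * t - j%:R * (pi / 2).
have -> : m.+1%:R * t - j.+1%:R * (pi / 2) = y - pi / 2.
  by rewrite /y -(natr1 j); ring.
rewrite sinB cos_pihalf sin_pihalf mulr0 mulr1 sub0r opprK.
rewrite exprS; field.
by rewrite expf_neq0 ?pnatr_eq0//= addrC natr1 pnatr_eq0.
Qed.

Lemma smooth_mode j m : smooth (mode j m).
Proof.
apply: smooth_mul; first exact: smooth_cst.
apply: smooth_comp; last exact: smooth_affine.
by have [] := smooth_cos_sin R.
Qed.

Lemma smooth_kernel j M : smooth (pkernel j M).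
Proof.
apply: smooth_mul; first exact: smooth_cst.
by do 2! (apply: smooth_sum => ?); exact: smooth_mode.
Qed.

Lemma is_derive_bigsum n (h : 'I_n -> R -> R) (dh : 'I_n -> R) t :
  (forall i, is_derive t 1 (h i) (dh i)) ->
  is_derive t 1 (fun t => \sum_(i < n) h i t) (\sum_(i < n) dh i).
Proof.
move=> hd; rewrite (_ : (fun t => _) = \sum_(i < n) h i).
  exact: is_derive_sum.
by apply/funext => u; rewrite fct_sumE.
Qed.

Lemma is_derive_kernel j M t : is_derive t 1 (pkernel j.+1 M) (pkernel j M t).
Proof.
have h1 : is_derive t 1 (fun t => \sum_(p < M) \sum_(m < p) mode j.+1 m t)
   (\sum_(p < M) \sum_(m < p) mode j m t).
  by do 2! apply: is_derive_bigsum => ?; exact: is_derive_mode.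
have h := @is_deriveM _ _ _ _ _ _ _ _ (is_derive_cst (M%:R^-1 : R) t 1) h1.
by apply: is_derive_eq h _; rewrite /GRing.scale/= mulr0 addr0.
Qed.

Let dirichlet p t : R := 1 + \sum_(m < p) mode 0 m t.

Let fejerE M t : (0 < M)%N -> M%:R * fejer M t = \sum_(p < M) dirichlet p t.
Proof.
move=> M0; rewrite /fejer /pkernel mulrDr mulrA mulfV ?pnatr_eq0 -?lt0n//.
by rewrite mulr1 mul1r big_split/= sumr_const card_ord.
Qed.

Let mode0E m t : mode 0 m t = 2 * cos (m.+1%:R * t).
Proof. by rewrite /mode expr0 invr1 mulr1 mul0r subr0. Qed.

Let dirichlet_cos p t :
  (1 - cos t) * dirichlet p t = cos (p%:R * t) - cos (p.+1%:R * t).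
Proof.
elim: p => [|p IH]; first by rewrite /dirichlet big_ord0 addr0 mulr1 mul0r mul1r cos0.
rewrite /dirichlet big_ord_recr/= addrA mulrDr IH mode0E.
have -> : cos (p.+2%:R * t) =
    cos (p.+1%:R * t) * cos t - sin (p.+1%:R * t) * sin t.
  by rewrite -cosD -(natr1 p.+1) mulrDl mul1r.
have -> : cos (p%:R * t) =
    cos (p.+1%:R * t) * cos t + sin (p.+1%:R * t) * sin t.
  by rewrite -cosB -(natr1 p) mulrDl mul1r addrK.
ring.
Qed.

(** The Fejer kernel concentrates at the multiples of 2 * pi. *)
Lemma fejer_cos M t : (0 < M)%N -> (1 - cos t) * fejer M t <= 2 / M%:R.
Proof.
move=> M0; have M0' : (0 : R) < M%:R by rewrite ltr0n.
rewrite ler_pdivlMr// -mulrA [fejer _ _ * _]mulrC fejerE//.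
have -> : (1 - cos t) * (\sum_(p < M) dirichlet p t) = 1 - cos (M%:R * t).
  elim: {M0 M0'} M => [|M IH]; first by rewrite big_ord0 mulr0 mul0r cos0 subrr.
  by rewrite big_ord_recr/= mulrDr IH dirichlet_cos addrA subrK.
by have := cos_geN1 (M%:R * t); lra.
Qed.

(** M * fejer M t is the squared modulus of the geometric sum of exp (imt). *)
Lemma fejer_ge0 M t : (0 < M)%N -> 0 <= fejer M t.
Proof.
move=> M0; have M0' : (0 : R) < M%:R by rewrite ltr0n.
rewrite -(pmulr_rge0 _ M0') fejerE//.
suff -> : \sum_(p < M) dirichlet p t =
    (\sum_(m < M) cos (m%:R * t)) ^+ 2 + (\sum_(m < M) sin (m%:R * t)) ^+ 2.
  by rewrite addr_ge0// sqr_ge0.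
elim: {M0 M0'} M => [|M IH]; first by rewrite !big_ord0 expr0n/= addr0.
rewrite !big_ord_recr/= IH.
set C := \sum_(_ < _) cos _; set S := \sum_(_ < _) sin _.
suff h : dirichlet M t = 1 + 2 * (C * cos (M%:R * t) + S * sin (M%:R * t)).
  rewrite h; have := cos2Dsin2 (M%:R * t); move: (cos (M%:R * t)) (sin _) => x y.
  by move=> e; lra.
rewrite /dirichlet; congr (1 + _).
rewrite /C /S !mulr_suml -big_split/= mulr_sumr.
rewrite (reindex_inj rev_ord_inj)/=; apply: eq_bigr => i _.
rewrite mode0E addrC [sin _ * _]mulrC [cos _ * _]mulrC addrC -cosB.
congr (2 * cos _); rewrite -mulrBl; congr (_ * _).
by rewrite subnSK// natrB// ltnW.
Qed.

(** All the modes of pkernel 1 are sines. *)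
Lemma kernel1_node M (k : nat) : pkernel 1 M (k%:R * pi) = 0.
Proof.
rewrite /pkernel big1 ?mulr0// => p _; rewrite big1// => m _.
rewrite /mode mul1r cosB cos_pihalf sin_pihalf mulr0 mulr1 add0r.
suff -> : sin (m.+1%:R * (k%:R * pi)) = 0 :> R by rewrite mulr0.
rewrite mulrA -natrM; elim: (m.+1 * k)%N => [|q IH]; first by rewrite mul0r sin0.
by rewrite -natr1 mulrDl mul1r sinDpi IH oppr0.
Qed.

(** Positivity of the Fejer kernel makes pkernel 1 M t + t nondecreasing, which
    squeezes it between its values at consecutive multiples of pi. *)
Lemma kernel1_bound M t : (0 < M)%N -> 0 <= t -> `|pkernel 1 M t| <= pi.
Proof.
move=> M0 t0.
pose q := Num.truncn (t / pi).
have /andP[q1 q2] : q%:R * pi <= t < q.+1%:R * pi.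
  rewrite -ler_pdivlMr ?pi_gt0// -ltr_pdivrMr ?pi_gt0//.
  by apply: truncn_itv; rewrite divr_ge0// pi_ge0.
pose g t : R := pkernel 1 M t + t.
have dg (u : R) : is_derive u 1 g (fejer M u).
  by rewrite /fejer addrC; apply: is_deriveD; exact: is_derive_kernel.
have mg (a b : R) : a <= b -> g a <= g b.
  move=> ab.
  have cg : {within `[a, b]%classic, continuous g}.
    apply: continuous_subspaceT => x; apply: smooth_continuous.
    by apply: smooth_add; [exact: smooth_kernel|exact: smooth_id].
  have [c _ hc] := MVT_segment ab (fun x _ => dg x) cg.
  by rewrite -subr_ge0 hc mulr_ge0 ?fejer_ge0// subr_ge0.
have := mg _ _ q1; have := mg _ _ (ltW q2).
rewrite /g !kernel1_node !add0r.
move: q1 q2; rewrite -(natr1 q) mulrDl mul1r => q1 q2 h1 h2.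
by rewrite ler_norml; apply/andP; split; lra.
Qed.

(* Telescoping, from 1 / (p + 1) ^ 2 <= 1 / p - 1 / (p + 1). At p = 0 the
   inverse is 0 and the bound is 2. *)
Let sum_inv_square p : \sum_(m < p) (m.+1%:R ^- 2 : R) <= 2 - p%:R^-1.
Proof.
case: p => [|p]; first by rewrite big_ord0 invr0 subr0.
elim: p => [|p IH]; first by rewrite big_ord1 expr1n invr1; lra.
rewrite big_ord_recr/=; apply: le_trans (lerD IH (lexx _)) _.
have e : (p.+2%:R : R) = p.+1%:R + 1 by rewrite natr1.
have p0 : (0 : R) < p.+1%:R by [].
rewrite e; move: (p.+1%:R : R) p0 => x x0.
rewrite -subr_ge0.
have -> : 2 - (x + 1)^-1 - (2 - x^-1 + (x + 1) ^- 2) = x^-1 * (x + 1) ^- 2.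
  by field; rewrite !gt_eqF//; lra.
by rewrite mulr_ge0// invr_ge0 ?exprn_ge0//; lra.
Qed.

Lemma kernel_bound_ge2 j M t : (1 < j)%N -> (0 < M)%N -> `|pkernel j M t| <= 4.
Proof.
move=> j1 M0; have M0' : (0 : R) < M%:R by rewrite ltr0n.
rewrite /pkernel normrM ger0_norm ?invr_ge0 ?ler0n//. rewrite ler_pdivrMl//.
apply: le_trans (ler_norm_sum _ _ _) _.
have -> : M%:R * 4 = \sum_(p < M) (4 : R) by rewrite sumr_const card_ord mulr_natl.
apply: ler_sum => p _; apply: le_trans (ler_norm_sum _ _ _) _.
apply: (@le_trans _ _ (\sum_(m < p) 2 * (m.+1%:R ^- 2 : R))).
  apply: ler_sum => m _; rewrite /mode 2!normrM normr_nat -mulrA ler_wpM2l//.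
  rewrite ger0_norm; last by rewrite invr_ge0 exprn_ge0.
  rewrite -[leRHS]mulr1 ler_pM ?invr_ge0 ?exprn_ge0//.
    by rewrite lef_pV2 ?posrE ?exprn_gt0// ler_weXn2l// ler1n.
  by rewrite ler_norml cos_le1 cos_geN1.
rewrite -mulr_sumr.
have := sum_inv_square p; have : (0 : R) <= p%:R^-1 by rewrite invr_ge0.
lra.
Qed.

(** The point of the averaging over p: the bound does not depend on M even for
    j = 1, where the series of absolute values diverges. *)
Lemma kernel_bounded j : (0 < j)%N -> exists2 C, 0 < C &
  forall M t, (0 < M)%N -> 0 <= t -> `|pkernel j M t| <= C.
Proof.
case: j => [//|[|j]] _.
  by exists pi; [exact: pi_gt0|exact: kernel1_bound].
by exists 4 => // M t M0 _; exact: kernel_bound_ge2.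
Qed.

End Kernel.

(** * Derivatives of the weight are dominated by its square root *)

Section Weight.
Variable R : realType.
Implicit Types (f rho : R -> R) (x y h : R).

(** The discrete form of the Landau-Kolmogorov inequality: iterating the
    one-step bound, with h rescaled so that the top term can be absorbed, leaves
    only the two extreme terms. *)
Lemma landau_sequence (m : nat) : exists2 C : R, 0 < C &
  forall s : nat -> R, (forall j, 0 <= s j) ->
  (forall j h, 0 < h -> s j.+1 * h <= 2 * s j + h ^+ 2 * s j.+2) ->
  forall j h, (j <= m)%N -> 0 < h -> s j * h ^+ j <= C * (s 0%N + h ^+ m * s m).
Proof.
elim: m => [|m [C C0 IH]].
  exists 1 => // s s0 _ j h; rewrite leqn0 => /eqP-> _.
  by rewrite expr0; have := s0 0%N; lra.
exists (1 + 2 * C + 8 * C ^+ 2) => [|s s0 hs j h]; first by nra.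
have e0 := s0 0%N.
rewrite leq_eqVlt => /orP[/eqP->|jm] h0.
  have X0 : 0 <= h ^+ m.+1 * s m.+1 by rewrite mulr_ge0// exprn_ge0// ltW.
  by rewrite mulrC; nra.
have X0 : 0 <= h ^+ m.+1 * s m.+1 by rewrite mulr_ge0// exprn_ge0// ltW.
have key : h ^+ m * s m <= s 0%N + 8 * C * (h ^+ m.+1 * s m.+1).
  case: m IH jm X0 => [|q] IH jm X0; first by rewrite expr0 mul1r; nra.
  (* The step 4 C h gives the middle term the coefficient 1 / 2. *)
  have eta0 : 0 < 4 * C by lra.
  have h1 := hs q (4 * C * h) (mulr_gt0 eta0 h0).
  have h2 := IH s s0 hs q h (leqnSn q) h0.
  have hq : 0 < h ^+ q by rewrite exprn_gt0.
  have h3 := ler_wpM2l (ltW hq) h1.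
  rewrite !exprS in X0 h2 *.
  move: (s 0%N) (s q) (s q.+1) (s q.+2) (h ^+ q) e0 X0 h2 h3 hq.
  move=> a b c d H a0 X0 h2 h3 H0.
  have h4 : 2 * (b * H) <= 2 * (C * (a + h * H * c)) by rewrite ler_pM2l.
  have C2 : 0 < 2 * C by lra.
  rewrite -(ler_pM2l C2); lra.
have := IH s s0 hs j h jm h0.
move=> h2; apply: le_trans h2 _.
move: key; set Y := h ^+ m * s m; set X := h ^+ m.+1 * _ in X0 *; nra.
Qed.

(** The one-step bound comes from the second-order Taylor formula at y and y + h.
    Suprema over half-lines rather than over intervals of length h keep both
    sides of the recursion on the same set. *)
Lemma tail_landau (m : nat) : exists2 C : R, 0 < C &
  forall f x (S0 Sm : R), smooth f ->
  (forall j, exists M, forall y, `|derive1n j f y| <= M) ->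
  (forall y, x <= y -> `|f y| <= S0) ->
  (forall y, x <= y -> `|derive1n m f y| <= Sm) ->
  forall j h, (j <= m)%N -> 0 < h ->
    `|derive1n j f x| * h ^+ j <= C * (S0 + h ^+ m * Sm).
Proof.
have [C C0 hC] := landau_sequence m; exists C => // f x S0 Sm sf bf hS0 hSm.
pose A j : set R := [set `|derive1n j f y| | y in [set y | x <= y]].
pose s j := sup (A j).
have A0 j : A j !=set0 by exists `|derive1n j f x|; exists x => //=; exact: lexx.
have Ab j : has_ubound (A j).
  by have [M hM] := bf j; exists M => _ [y _ <-].
have As j y : x <= y -> `|derive1n j f y| <= s j.
  by move=> xy; apply: ub_le_sup => //; exists y.
have s0 j : 0 <= s j by apply: le_trans (As j x (lexx _)).
have step j h : 0 < h -> s j.+1 * h <= 2 * s j + h ^+ 2 * s j.+2.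
  move=> h0; rewrite -ler_pdivlMr//; apply: ge_sup => // _ [y /= xy <-].
  rewrite ler_pdivlMr//.
  have cont k : {within `[y, y + h]%classic, continuous (derive1n k f)}.
    apply: continuous_subspaceT; exact/smooth_continuous/smooth_derive1n.
  have dd k (z : R) : is_derive z 1 (derive1n k f) (derive1n k.+1 f z).
    by rewrite derive1nS; exact/smooth_is_derive/smooth_derive1n.
  have yh : y <= y + h by lra.
  have [z] := MVT_segment yh (fun z _ => dd j z) (cont j).
  rewrite in_itv/= => /andP[yz zh] e1.
  have cont' : {within `[y, z]%classic, continuous (derive1n j.+1 f)}.
    apply: continuous_subspaceT; exact/smooth_continuous/smooth_derive1n.
  have [w] := MVT_segment yz (fun z _ => dd j.+1 z) cont'.
  rewrite in_itv/= => /andP[yw wz] e2.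
  have -> : `|derive1n j.+1 f y| * h = `|derive1n j f (y + h) - derive1n j f y
      - derive1n j.+2 f w * (z - y) * h|.
    rewrite e1 -e2 -[in LHS](gtr0_norm h0) -normrM; congr (`|_|); rewrite derive1nS; ring.
  apply: le_trans (ler_normB _ _) _; apply: lerD.
    apply: le_trans (ler_normB _ _) _.
    have a1 : x <= y + h by lra.
    by have := As j (y + h) a1; have := As j y xy; lra.
  have a2 : x <= w by lra.
  rewrite !normrM (gtr0_norm h0) [`|z - y|]ger0_norm ?subr_ge0//.
  have -> : h ^+ 2 * s j.+2 = s j.+2 * h * h by ring.
  by rewrite ler_pM2r// ler_pM ?subr_ge0 ?As//; lra.
move=> j h jm h0.
apply: (@le_trans _ _ (s j * h ^+ j)).
  by rewrite ler_wpM2r ?exprn_ge0 ?(ltW h0)//; exact: As.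
apply: le_trans (hC s s0 step j h jm h0) _.
rewrite ler_pM2l//; apply: lerD.
  by apply: ge_sup => // _ [y /= xy <-]; exact: hS0.
rewrite ler_pM2l ?exprn_gt0//.
by apply: ge_sup => // _ [y /= xy <-]; exact: hSm.
Qed.

Lemma le_root_bound (t D : R) (N : nat) : (0 < N)%N -> 0 <= t ->
  t ^+ N <= D -> t <= 1 + D.
Proof.
case: N => [//|N] _ t0 h; have [t1|t1] := leP t 1.
  by apply: le_trans t1 _; rewrite lerDl (le_trans _ h)// exprn_ge0.
have := exprn_ege1 N (ltW t1); rewrite exprS in h; nra.
Qed.

(** As f is nonincreasing on the tail, its supremum over [x, oo) is f x. Taking
    h ^ N = f x in the interpolation inequality bounds the j-th derivative by a
    power of f x that exceeds 1 / 2, and the excess absorbs the polynomial. *)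
Lemma derive_le_sqrt_tail f (K : R) : smooth f ->
  (forall a b, exists C, forall x, `|x| ^+ a * `|derive1n b f x| <= C) ->
  (forall x, 0 < f x) -> (forall x y, K <= x -> x <= y -> f y <= f x) ->
  forall j m, exists2 C, 0 <= C &
    forall x, K <= x -> `|x| ^+ m * `|derive1n j f x| <= C * Num.sqrt (f x).
Proof.
move=> sf decay f0 mono j m.
pose N := (4 * j.+1)%N.
have [C C0 hC] := tail_landau N.
have bf b : exists M, forall y, `|derive1n b f y| <= M.
  by have [M hM] := decay 0%N b; exists M => y; have := hM y; rewrite expr0 mul1r.
have [M hM] := bf N.
have [D1 hD1] := decay 0%N 0%N; have [D2 hD2] := decay (m * N)%N 0%N.
have M0 : 0 <= M by apply: le_trans (hM 0).
have D10 : 0 <= D1 by apply: le_trans (hD1 0); rewrite mulr_ge0 ?exprn_ge0.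
have D20 : 0 <= D2.
  by apply: le_trans (hD2 0); rewrite mulr_ge0// exprn_ge0.
exists (C * (1 + M) * ((1 + D2) * (1 + D1) ^+ j.+1)).
  by rewrite !mulr_ge0// ?exprn_ge0//; lra.
move=> x Kx; set r := f x.
have r0 : 0 < r by exact: f0.
have N0 : (0 < N)%N by [].
pose h := r `^ N%:R^-1.
have h0 : 0 < h by rewrite powR_gt0.
have hN : h ^+ N = r.
  by rewrite -powR_mulrn ?ltW// -powRrM mulVf ?pnatr_eq0// powRr1// ltW.
have sq : Num.sqrt r = h ^+ (2 * j.+1).
  by rewrite -hN /N (_ : 4 * j.+1 = (2 * j.+1) * 2)%N ?exprM ?sqrtr_sqr ?ger0_norm ?exprn_ge0 ?ltW// mulnAC.
(* After the factor h ^ (2 (j + 1)) = sqrt (f x) is split off, the remaining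
   h ^ (j + 2) pays for the polynomial with one factor h. *)
have hD : h <= 1 + D1.
  apply: (@le_root_bound _ _ N) => //; first exact: ltW.
  by rewrite hN; have := hD1 x; rewrite expr0 mul1r derive1n0 gtr0_norm.
have xh : `|x| ^+ m * h <= 1 + D2.
  apply: (@le_root_bound _ _ N) => //; first by rewrite mulr_ge0 ?exprn_ge0// ltW.
  by rewrite exprMn -exprM hN; have := hD2 x; rewrite derive1n0 (gtr0_norm (f0 x)).
have jN : (j <= N)%N by clear; rewrite /N; lia.
have := hC f x r M sf bf _ (fun y _ => hM y) j h jN h0.
have hr y : x <= y -> `|f y| <= r by move=> xy; rewrite gtr0_norm//; exact: mono.
move=> /(_ hr); rewrite hN.
have -> : C * (r + r * M) = (C * (1 + M) * h ^+ (N - j)) * h ^+ j.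
  by rewrite -mulrA -exprD subnK// hN; ring.
rewrite ler_pM2r ?exprn_gt0// => hj.
apply: le_trans (ler_wpM2l (exprn_ge0 m (normr_ge0 x)) hj) _.
have -> : (N - j = 2 * j.+1 + 1 + j.+1)%N by clear; rewrite /N; lia.
rewrite sq.
rewrite !exprD expr1.
have -> : `|x| ^+ m * (C * (1 + M) * (h ^+ (2 * j.+1) * h * h ^+ j.+1)) =
  (C * (1 + M)) * (h ^+ (2 * j.+1) * ((`|x| ^+ m * h) * h ^+ j.+1)) by ring.
rewrite -!mulrA ler_pM2l// ler_pM2l; last lra.
rewrite [(1 + D2) * _]mulrA [leRHS]mulrC ler_pM2l ?exprn_gt0// mulrA.
apply: ler_pM => //; first by rewrite mulr_ge0 ?exprn_ge0// ltW.
  by rewrite exprn_ge0// ltW.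
by rewrite lerXn2r ?nnegrE ?(ltW h0)//; lra.
Qed.

Lemma smooth_reflect f : smooth f -> smooth (fun x => f (- x)).
Proof. by move=> sf; apply: (smooth_comp sf); apply/smooth_opp/smooth_id. Qed.

Lemma derive1n_reflect j f : smooth f ->
  derive1n j (fun x => f (- x)) = fun x => (-1) ^+ j * derive1n j f (- x).
Proof.
move=> sf; elim: j => [|j IH]; first by apply/funext => x; rewrite expr0 mul1r.
have sj : smooth (derive1n j f) by exact: smooth_derive1n.
have sr := smooth_reflect sj.
rewrite derive1nS IH derive1_mul; last 2 first.
- by move=> x; exact: derivable_cst.
- by move=> x; exact: smooth_derivable.
apply/funext => x.
rewrite derive1_cst mul0r add0r (@derive1_compE _ (derive1n j f) -%R); last 2 first.
- by move=> y; exact: smooth_derivable.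
- by move=> y; exact: derivable_opp.
have -> : derive1 -%R x = -1 :> R by rewrite derive1E derive_val.
by rewrite derive1nS exprS; ring.
Qed.

(** Outside a compact set this is interpolation between the monotone weight
    and a bounded derivative of high order; on it the weight is bounded below. *)
Lemma schwartz_mon_derive_le rho : schwartz_mon rho ->
  forall j m, exists2 C, 0 <= C &
    forall x, `|x| ^+ m * `|derive1n j rho x| <= C * Num.sqrt (rho x).
Proof.
move=> [[sr dr] rho0 [K0 [K00 mono]]] j m.
have decay a b : exists C, forall x, `|x| ^+ a * `|derive1n b rho x| <= C.
  have [C hC] := dr a b; exists C => x.
  by rewrite -normrX -normrM; apply: hC; exists x.
pose K := K0 + 1.
have dd (z : R) : is_derive z 1 rho (derive1 rho z) by exact: smooth_is_derive.
have cont a b : {within `[a, b]%classic, continuous rho}.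
  by apply: continuous_subspaceT; exact: smooth_continuous.
have right x y : K <= x -> x <= y -> rho y <= rho x.
  move=> Kx xy; have [z] := MVT_segment xy (fun z _ => dd z) (cont x y).
  rewrite in_itv/= => /andP[xz zy] e.
  have zK : z \notin `[- K0, K0].
    by rewrite in_itv/= negb_and -!ltNge; apply/orP; right; rewrite /K in Kx; lra.
  have := mono z zK; rewrite pmulr_rle0; last by rewrite /K in Kx; lra.
  by move=> dz; rewrite -subr_le0 e mulr_le0_ge0// subr_ge0.
have left x y : x <= y -> y <= - K -> rho x <= rho y.
  move=> xy yK; have [z] := MVT_segment xy (fun z _ => dd z) (cont x y).
  rewrite in_itv/= => /andP[xz zy] e.
  have zK : z \notin `[- K0, K0].
    by rewrite in_itv/= negb_and -!ltNge; apply/orP; left; rewrite /K in yK; lra.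
  have := mono z zK; rewrite nmulr_rle0; last by rewrite /K in yK; lra.
  by move=> dz; rewrite -subr_ge0 e mulr_ge0// subr_ge0.
have [C1 C10 hC1] := derive_le_sqrt_tail sr decay rho0 right j m.
pose r x := rho (- x).
have decayr a b : exists C, forall x, `|x| ^+ a * `|derive1n b r x| <= C.
  have [C hC] := decay a b; exists C => x; have := hC (- x).
  by rewrite /r derive1n_reflect// normrN normrM normrX normrN1 expr1n mul1r.
have rmono x y : K <= x -> x <= y -> r y <= r x.
  by move=> Kx xy; apply: left; lra.
have [C2 C20 hC2] := derive_le_sqrt_tail (smooth_reflect sr) decayr
  (fun x => rho0 (- x)) rmono j m.
have NK : - K <= K by rewrite /K; lra.
have [z0 _ hz0] := EVT_min NK (cont (- K) K).
have [D hD] := decay m j.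
have D0 : 0 <= D by apply: le_trans (hD 0); rewrite mulr_ge0 ?exprn_ge0.
have s0 : 0 < Num.sqrt (rho z0) by rewrite sqrtr_gt0.
exists (C1 + C2 + D / Num.sqrt (rho z0)).
  by rewrite !addr_ge0// divr_ge0// ltW.
move=> x; have sx : 0 <= Num.sqrt (rho x) by exact: sqrtr_ge0.
have D' : 0 <= D / Num.sqrt (rho z0) by rewrite divr_ge0// ltW.
have [Kx|xK] := leP K x.
  apply: le_trans (hC1 x Kx) _; rewrite ler_wpM2r//; lra.
have [xNK|Kx] := leP x (- K).
  have Kx : K <= - x by lra.
  have := hC2 (- x) Kx.
  rewrite /r derive1n_reflect// normrN normrM normrX normrN1 expr1n mul1r opprK.
  by move=> h; apply: le_trans h _; rewrite ler_wpM2r//; lra.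
apply: le_trans (hD x) _.
apply: (@le_trans _ _ (D / Num.sqrt (rho z0) * Num.sqrt (rho x))).
  rewrite -mulrA ler_peMr// mulrC ler_pdivlMr// mul1r ler_wsqrtr//.
  by apply: hz0; rewrite in_itv/= !ltW.
by rewrite ler_wpM2r//; lra.
Qed.

End Weight.

(** * Integration tools *)

Section Integration.
Variable R : realType.
Implicit Types (f g : R -> R) (x : R).
Notation mu := (@lebesgue_measure R).
Notation integ f := (mu.-integrable setT (EFin \o f)).

Lemma integ_dom f g : measurable_fun setT f -> (forall x, `|f x| <= g x) ->
  integ g -> integ f.
Proof.
move=> mf fg; apply: le_integrable => //; first exact/measurable_EFinP.
by move=> x _ /=; rewrite lee_fin (le_trans (fg x))// ler_norm.
Qed.

Lemma integ_scale (a : R) f : integ f -> integ (fun x => a * f x).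
Proof.
move=> hf; have := @integrableZl _ _ _ mu setT measurableT a _ hf.
by apply: eq_integrable => // x _ /=; rewrite EFinM.
Qed.

Lemma integ_add f g : integ f -> integ g -> integ (fun x => f x + g x).
Proof.
move=> hf hg; have := @integrableD _ _ _ mu setT measurableT _ _ hf hg.
by apply: eq_integrable => // x _ /=; rewrite EFinD.
Qed.

Lemma integ_compact_support f (A : R) : continuous f ->
  (forall x, A < `|x| -> f x = 0) -> integ f.
Proof.
move=> cf f0.
have : mu.-integrable `[- A, A]%classic (EFin \o f).
  apply: continuous_compact_integrable; first exact: segment_compact.
  exact: continuous_subspaceT.
move=> /integrable_mkcond => /(_ (measurable_itv _)).
apply: eq_integrable => // x _; rewrite patchE; case: ifPn => //.
rewrite notin_setE/= in_itv/= -ler_norml => /negP; rewrite -ltNge => xA.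
by rewrite f0.
Qed.

Lemma integ_oneDsqr : integ (fun x => (1 + x ^+ 2)^-1).
Proof.
have c1 : continuous (fun x : R => (oneDsqr x)^-1).
  exact: continuous_oneDsqrV.
apply/integrableP; split.
  by apply/measurable_EFinP; exact: (continuous_measurable_fun c1).
under eq_integral => x _ do
  rewrite /= ger0_norm ?invr_ge0 ?(le_trans _ (oneDsqr_ge1 x))//.
rewrite ge0_symfun_integralT//; last 2 first.
- by move=> x; rewrite invr_ge0 (le_trans _ (oneDsqr_ge1 x)).
- by move=> x /=; rewrite sqrrN.
rewrite -set_itvcy integral0y_oneDsqr -EFinM; exact: ltry.
Qed.

Lemma integ_of_integral_le f (M : R) : measurable_fun setT f ->
  (forall x, 0 <= f x) -> (\int[mu]_x (f x)%:E <= M%:E)%E ->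
  integ f /\ \int[mu]_x f x <= M.
Proof.
move=> mf f0 h.
have i : integ f.
  apply/integrableP; split; first exact/measurable_EFinP.
  under eq_integral => x _ do rewrite /= ger0_norm//.
  exact: le_lt_trans h (ltry _).
split=> //; rewrite -lee_fin fineK//; exact: integrable_fin_num.
Qed.

Lemma Rintegral_ler f g : integ f -> integ g -> (forall x, f x <= g x) ->
  \int[mu]_x f x <= \int[mu]_x g x.
Proof. by move=> hf hg h; apply: le_Rintegral => // x _; exact: h. Qed.

Lemma norm_Rintegral_le f g : measurable_fun setT f -> integ g ->
  (forall x, `|f x| <= g x) -> `|\int[mu]_x f x| <= \int[mu]_x g x.
Proof.
move=> mf hg fg; have hf := integ_dom mf fg hg.
apply: le_trans (le_normr_Rintegral measurableT hf) _.
by apply: Rintegral_ler => //; exact: integrable_norm.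
Qed.

(** The Cauchy-Schwarz inequality against the square-integrable function
    1 / (1 + |x|), in the form given by ab <= a^2 / S + S b^2. *)
Lemma weighted_cauchy_schwarz (p g phi : R -> R) (D S : R) :
  measurable_fun setT phi -> measurable_fun setT g -> measurable_fun setT p ->
  (forall x, 0 <= p x) -> 0 < S -> 0 <= D ->
  (\int[mu]_x (g x ^+ 2 * p x)%:E <= (S ^+ 2)%:E)%E ->
  (forall x, (1 + `|x|) * `|phi x| <= D * (`|g x| * Num.sqrt (p x))) ->
  `|\int[mu]_x phi x| <= D * S * (1 + \int[mu]_x (1 + x ^+ 2)^-1).
Proof.
move=> mphi mg mp p0 S0 D0 hS hphi.
have mG : measurable_fun setT (fun x => g x ^+ 2 * p x).
  by apply: measurable_funM => //; exact: measurable_funX.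
have G0 x : 0 <= g x ^+ 2 * p x by rewrite mulr_ge0// sqr_ge0.
have [iG hG] := integ_of_integral_le mG G0 hS.
have iW := integ_oneDsqr.
have iH : integ (fun x => D * (S^-1 * (g x ^+ 2 * p x) + S * (1 + x ^+ 2)^-1)).
  by apply: integ_scale; apply: integ_add; exact: integ_scale.
apply: le_trans (norm_Rintegral_le mphi iH _) _ => [x|].
  have a1 : 0 < 1 + `|x| by rewrite ltr_pwDl.
  rewrite -(ler_pM2l a1); apply: le_trans (hphi x) _.
  rewrite [leRHS]mulrCA ler_wpM2l//.
  have -> : g x ^+ 2 * p x = (`|g x| * Num.sqrt (p x)) ^+ 2.
    by rewrite exprMn sqr_sqrtr// real_normK// num_real.
  move: (`|g x| * _) => a.
  have e : x ^+ 2 = `|x| ^+ 2 by rewrite real_normK// num_real.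
  rewrite e; have : 0 <= `|x| by [].
  move: `|x| a1 => y a1 y0.
  have q0 : 0 < 1 + y ^+ 2 by rewrite ltr_pwDl// sqr_ge0.
  rewrite -subr_ge0.
  have -> : (1 + y) * (S^-1 * a ^+ 2 + S / (1 + y ^+ 2)) - a =
    (S * (1 + y ^+ 2))^-1 * ((1 + y) * (a ^+ 2 * (1 + y ^+ 2) + S ^+ 2)
       - a * S * (1 + y ^+ 2)).
    by field; rewrite !gt_eqF.
  rewrite mulr_ge0 ?invr_ge0 ?mulr_ge0 ?(ltW S0) ?(ltW q0)//.
  (* Completing the square in a, after multiplication by 4 (1 + y). *)
  rewrite -(pmulr_rge0 _ (_ : 0 < 4 * (1 + y))) ?mulr_gt0//.
  have -> : 4 * (1 + y) * ((1 + y) * (a ^+ 2 * (1 + y ^+ 2) + S ^+ 2)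
      - a * S * (1 + y ^+ 2)) = (1 + y ^+ 2) * (2 * (1 + y) * a - S) ^+ 2
      + S ^+ 2 * (4 * (1 + y) ^+ 2 - (1 + y ^+ 2)) by ring.
  by rewrite addr_ge0// mulr_ge0 ?sqr_ge0 ?(ltW q0)//; nra.
rewrite RintegralZl// ?RintegralD// ?RintegralZl//; try exact: integ_scale; last first.
  by apply: integ_add; exact: integ_scale.
rewrite -mulrA ler_wpM2l// mulrDr mulr1 lerD2r.
by rewrite ler_pdivrMl// -expr2.
Qed.

End Integration.

(** * Families of compactly supported weights *)

Section Families.
Variable R : realType.
Implicit Types (s rho f : R -> R) (a b : nat -> R -> R) (x : R).

(** The constants do not depend on the index N of the family. This uniformity is
    what allows the cutoff to be removed once the estimate is proved. *)
Definition rapid s a := forall i m, exists2 C : R, 0 <= C &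
  forall N x, (1 + `|x|) ^+ m * `|derive1n i (a N) x| <= C * s x.

Definition tempered b := forall i, exists m, exists2 C : R, 0 <= C &
  forall N x, `|derive1n i (b N) x| <= C * (1 + `|x|) ^+ m.

Lemma rapid_derive s a : rapid s a -> rapid s (fun N => derive1 (a N)).
Proof.
move=> h i m; have [C C0 hC] := h i.+1 m; exists C => // N x.
by rewrite -derive1Sn.
Qed.

Lemma tempered_derive b : tempered b -> tempered (fun N => derive1 (b N)).
Proof.
move=> h i; have [m [C C0 hC]] := h i.+1; exists m, C => // N x.
by rewrite -derive1Sn.
Qed.

Lemma rapid_mul s a b : (forall N, smooth (a N)) -> (forall N, smooth (b N)) ->
  rapid s a -> tempered b -> rapid s (fun N x => a N x * b N x).
Proof.
move=> sa sb ra tb i; elim: i a b sa sb ra tb => [|i IH] a b sa sb ra tb m.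
  have [q [C1 C10 h1]] := tb 0%N; have [C2 C20 h2] := ra 0%N (m + q)%N.
  exists (C1 * C2); first exact: mulr_ge0.
  move=> N x; have := h1 N x; have := h2 N x; rewrite !derive1n0 => e2 e1.
  have x0 : 0 <= (1 + `|x|) ^+ m by rewrite exprn_ge0// addr_ge0.
  rewrite normrM mulrA -mulrA -[leRHS]mulrA.
  apply: le_trans (ler_wpM2l x0 (ler_wpM2l (normr_ge0 _) e1)) _.
  have -> : (1 + `|x|) ^+ m * (`|a N x| * (C1 * (1 + `|x|) ^+ q)) =
    C1 * ((1 + `|x|) ^+ (m + q) * `|a N x|) by rewrite exprD; ring.
  by rewrite ler_wpM2l.
have sa' N : smooth (derive1 (a N)) by exact: smooth_derive1.
have sb' N : smooth (derive1 (b N)) by exact: smooth_derive1.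
have [C1 C10 h1] := IH _ _ sa' sb (rapid_derive ra) tb m.
have [C2 C20 h2] := IH _ _ sa sb' ra (tempered_derive tb) m.
exists (C1 + C2); first exact: addr_ge0.
move=> N x; rewrite derive1Sn derive1_mul; last 2 first.
- by move=> y; exact: smooth_derivable.
- by move=> y; exact: smooth_derivable.
rewrite derive1n_add; try exact: smooth_mul.
have x0 : 0 <= (1 + `|x|) ^+ m by rewrite exprn_ge0// addr_ge0.
apply: le_trans (ler_wpM2l x0 (ler_normD _ _)) _.
by rewrite mulrDr mulrDl lerD.
Qed.

Lemma rapid_add s a b : (forall N, smooth (a N)) -> (forall N, smooth (b N)) ->
  rapid s a -> rapid s b -> rapid s (fun N x => a N x + b N x).
Proof.
move=> sa sb ra rb i m.
have [C1 C10 h1] := ra i m; have [C2 C20 h2] := rb i m.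
exists (C1 + C2); first exact: addr_ge0.
move=> N x; rewrite derive1n_add//.
have x0 : 0 <= (1 + `|x|) ^+ m by rewrite exprn_ge0// addr_ge0.
apply: le_trans (ler_wpM2l x0 (ler_normD _ _)) _.
by rewrite mulrDr mulrDl lerD.
Qed.

Lemma tempered_cst (r : R) : tempered (fun _ _ => r).
Proof.
case=> [|i]; exists 0%N.
  by exists `|r| => // N x; rewrite expr0 mulr1.
by exists 0 => // N x; rewrite derive1n_cst normr0 mul0r.
Qed.

Lemma tempered_id : tempered (fun _ x => x).
Proof.
have d1 : derive1 (fun x : R => x) = fun=> 1.
  by apply: derive1_ext => x; exact: is_derive_id.
case=> [|[|i]]; [exists 1%N|exists 0%N|exists 0%N]; exists 1 => // N x.
- by rewrite expr1 mul1r lerDr.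
- by rewrite derive1n1 d1 normr1 expr0 mulr1.
- by rewrite derive1Sn d1 derive1n_cst normr0 expr0 mulr1.
Qed.

Definition cutoff N x : R := chi (N.+1%:R^-1 * x).

Lemma derive1n_dilate k (r : R) f : smooth f ->
  derive1n k (fun x => f (r * x)) = fun x => r ^+ k * derive1n k f (r * x).
Proof.
move=> sf; elim: k => [|k IH]; first by apply/funext => x; rewrite expr0 mul1r.
rewrite derive1nS IH; apply: derive1_ext => x.
have h1 := is_derive_affine r 0 x; rewrite /= in h1.
have sk : smooth (derive1n k f) by exact: smooth_derive1n.
have h2 := @is_derive1_comp _ (derive1n k f) (fun t => r * t + 0) x _ _
  (smooth_is_derive _ sk) h1.
have h := @is_deriveM _ _ _ _ _ _ _ _ (is_derive_cst (r ^+ k) x 1) h2.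
rewrite (_ : (fun _ => _) = (cst (r ^+ k)) * ((derive1n k f) \o (fun t => r * t + 0))).
  apply: is_derive_eq h _.
  by rewrite /GRing.scale/= mulr0 addr0 addr0 exprS; ring.
by apply/funext => y; rewrite /cst /= -[in LHS](addr0 (r * y)).
Qed.

Lemma smooth_cutoff N : smooth (cutoff N).
Proof.
apply: (@smooth_comp _ (@chi R)); first exact: smooth_chi.
by apply: smooth_mul; [exact: smooth_cst|exact: smooth_id].
Qed.

Lemma tempered_cutoff : tempered cutoff.
Proof.
move=> i; have [C hC] := @derive1n_chi_bounded R i.
exists 0%N, `|C| => // N x; rewrite expr0 mulr1.
rewrite derive1n_dilate; last exact: smooth_chi.
rewrite normrM -[leRHS]mul1r ler_pM//; last by apply: le_trans (hC _) (ler_norm _).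
rewrite ger0_norm ?exprn_ge0 ?invr_ge0// exprn_ile1 ?invr_ge0//.
by rewrite invf_le1// ler1n.
Qed.

Lemma cutoff_out N x : N.+1%:R < `|x| -> cutoff N x = 0.
Proof.
move=> h; apply: chi_out; rewrite normrM normfV normr_nat.
by rewrite ler_pdivlMl// mulr1 ltW.
Qed.

(** The coefficients that occur when derivatives are moved off the kernel: the
    class contains the truncated weight and is closed under differentiation and
    under multiplication by polynomials. *)
Record weight_family rho a : Prop := {
  family_smooth : forall N, smooth (a N) ;
  family_support : forall N x, N.+1%:R < `|x| -> a N x = 0 ;
  family_rapid : rapid (fun x => Num.sqrt (rho x)) a }.

Lemma weight_family_derive rho a :
  weight_family rho a -> weight_family rho (fun N => derive1 (a N)).
Proof.
move=> [sa za ra]; split.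
- by move=> N; exact: smooth_derive1.
- by move=> N x; rewrite -derive1n1; apply: derive1n_support => y; exact: za.
- exact: rapid_derive.
Qed.

Lemma weight_family_mul rho a b : (forall N, smooth (b N)) -> tempered b ->
  weight_family rho a -> weight_family rho (fun N x => a N x * b N x).
Proof.
move=> sb tb [sa za ra]; split.
- by move=> N; exact: smooth_mul.
- by move=> N x h; rewrite za// mul0r.
- exact: rapid_mul.
Qed.

Lemma weight_family_add rho a b :
  weight_family rho a -> weight_family rho b ->
  weight_family rho (fun N x => a N x + b N x).
Proof.
move=> [sa za ra] [sb zb rb]; split.
- by move=> N; exact: smooth_add.
- by move=> N x h; rewrite za// zb// addr0.
- exact: rapid_add.
Qed.

Lemma weight_family_cutoff rho : schwartz_mon rho ->
  weight_family rho (fun N x => rho x * cutoff N x).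
Proof.
move=> hrho; have [[sr _] _ _] := hrho; split.
- by move=> N; exact: (smooth_mul sr (@smooth_cutoff N)).
- by move=> N x h; rewrite cutoff_out// mulr0.
- apply: (@rapid_mul (fun x => Num.sqrt (rho x)) (fun=> rho) cutoff
    (fun _ => sr) (@smooth_cutoff) _ tempered_cutoff).
  move=> i m.
    have [C0 C00 h0] := schwartz_mon_derive_le hrho i 0.
    have [C1 C10 h1] := schwartz_mon_derive_le hrho i m.
    exists (2 ^+ m * (C0 + C1)); first by rewrite mulr_ge0 ?exprn_ge0 ?addr_ge0.
    move=> _ x; have := h0 x; have := h1 x; rewrite expr0 mul1r => e1 e0.
    apply: (@le_trans _ _ (2 ^+ m * (1 + `|x| ^+ m) * `|derive1n i rho x|)).
      rewrite ler_wpM2r//; have [x1|x1] := leP `|x| 1.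
        apply: (@le_trans _ _ (2 ^+ m)).
          by rewrite lerXn2r ?nnegrE ?addr_ge0//; lra.
        by rewrite ler_peMr ?exprn_ge0// lerDl exprn_ge0.
      apply: (@le_trans _ _ ((2 * `|x|) ^+ m)).
        by rewrite lerXn2r ?nnegrE ?addr_ge0 ?mulr_ge0//; lra.
      by rewrite exprMn ler_wpM2l ?exprn_ge0// lerDr.
    rewrite -!mulrA ler_wpM2l ?exprn_ge0// [leLHS]mulrDl mul1r [leRHS]mulrDl.
    exact: lerD.
Qed.

End Families.

(** * The error functional tested against smooth kernels *)

Section Pairing.
Variable R : realType.
Variables (c : R) (c_gt0 : 0 < c).
Implicit Types (s rho f u g : R -> R) (a b : nat -> R -> R) (x : R).
Notation mu := (@lebesgue_measure R).
Notation integ f := (mu.-integrable setT (EFin \o f)).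

(** The inverse of the Moebius change of variables, and the derivative of the
    change of variables expressed in the variable x. *)
Definition angle x : R := pi + 2 * atan (x / c).
Definition jac x : R := (2 * c)^-1 * (x * x) + c / 2.

Lemma jac_gt0 x : 0 < jac x.
Proof.
by rewrite /jac -expr2 ltr_wpDl ?divr_gt0// mulr_ge0 ?sqr_ge0 ?invr_ge0 ?mulr_ge0 ?ltW.
Qed.

Lemma angle_ge0 x : 0 <= angle x.
Proof. by rewrite /angle; have := atan_gtNpi2 (x / c); lra. Qed.

Lemma is_derive_angle x : is_derive x 1 angle (jac x)^-1.
Proof.
have h1 := is_derive_affine c^-1 0 x.
have h2 := @is_derive1_comp _ (@atan R) _ x _ _ (is_derive1_atan _) h1.
have h3 := @is_deriveM _ _ _ _ _ _ _ _ (is_derive_cst (2 : R) x 1) h2.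
have h := @is_deriveD _ _ _ _ _ _ _ _ _ (is_derive_cst (pi : R) x 1) h3.
rewrite (_ : angle = cst pi + (cst 2 * (@atan R \o (fun t => c^-1 * t + 0)))).
  apply: is_derive_eq h _.
  rewrite /GRing.scale/= mulr0 addr0 add0r /jac addr0.
  have q : 0 < x * x + c * c by rewrite ltr_wpDl ?mulr_gt0// -expr2 sqr_ge0.
  by field; rewrite !gt_eqF.
by apply/funext => y; rewrite /angle [y / c]mulrC -[in LHS](addr0 (c^-1 * y)).
Qed.

Lemma smooth_jac : smooth jac.
Proof.
apply: smooth_add; last exact: smooth_cst.
apply: smooth_mul; first exact: smooth_cst.
by apply: smooth_mul; exact: smooth_id.
Qed.

Lemma smooth_angle : smooth angle.
Proof.
apply: (smooth_antiderivative is_derive_angle).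
apply: smooth_inv; last exact: smooth_jac.
by move=> x; rewrite gt_eqF// jac_gt0.
Qed.

(** The kernels with mesh 2 pi / n on the circle, carried to the line and
    normalised so that jac d/dx maps wave n M j.+1 to wave n M j. *)
Definition wave (n M j : nat) x : R := n%:R ^- j * pkernel j M (n%:R * angle x).

Lemma smooth_wave n M j : smooth (wave n M j).
Proof.
apply: smooth_mul; first exact: smooth_cst.
apply: smooth_comp; first exact: smooth_kernel.
by apply: smooth_mul; [exact: smooth_cst|exact: smooth_angle].
Qed.

Lemma is_derive_wave n M j x : (0 < n)%N ->
  is_derive x 1 (wave n M j.+1) (wave n M j x / jac x).
Proof.
move=> n0.
have h1 := @is_deriveM _ _ _ _ _ _ _ _ (is_derive_cst (n%:R : R) x 1)
  (is_derive_angle x).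
have h2 := @is_derive1_comp _ (@pkernel R j.+1 M) _ x _ _ (is_derive_kernel _ _ _) h1.
have h := @is_deriveM _ _ _ _ _ _ _ _ (is_derive_cst (n%:R ^- j.+1 : R) x 1) h2.
apply: is_derive_eq h _.
rewrite /GRing.scale/= !mulr0 !addr0 /wave /= [((cst _ : R -> R) * _) x]/(n%:R * angle x).
rewrite exprS invfM; field.
by rewrite gt_eqF ?jac_gt0//= expf_neq0/= ?pnatr_eq0 -?lt0n.
Qed.

(** The data of a function of the weighted Sobolev space that the estimate uses:
    its weak derivatives enter only through the test function identity. *)
Definition sobolev_data (alpha : nat) rho u (S : R) : Prop :=
  continuous u /\
  forall k, (k <= alpha)%N -> exists g, [/\ measurable_fun setT g,
    (forall psi, test_function psi ->
      \int[mu]_x (u x * derive1n k psi x) = (-1) ^+ k * \int[mu]_x (g x * psi x)) &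
    (\int[mu]_x (g x ^+ 2 * rho x)%:E <= (S ^+ 2)%:E)%E].

Lemma test_function_support psi (A : R) : smooth psi ->
  (forall x, A < `|x| -> psi x = 0) -> test_function psi.
Proof.
move=> sp h; split=> //.
apply: (@subclosed_compact _ _ `[- A, A]%classic).
- exact: closed_closure.
- exact: segment_compact.
- rewrite -[X in _ `<=` X](_ : closure `[- A, A]%classic = _); last first.
    by apply/esym/closure_id; exact: itv_closed.
  apply: closure_subset => x /= px; rewrite in_itv/= -ler_norml leNgt.
  by apply: contra px => /h ->.
Qed.

Lemma integ_test u f (A : R) k : continuous u -> smooth f ->
  (forall x, A < `|x| -> f x = 0) -> integ (fun x => u x * derive1n k f x).
Proof.
move=> cu sf h; apply: (@integ_compact_support _ _ A).
  move=> x; apply: continuousM; first exact: cu.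
  exact/smooth_continuous/smooth_derive1n.
by move=> x Ax; rewrite (derive1n_support _ h)// mulr0.
Qed.

Lemma weight_family_jac rho a : weight_family rho a ->
  weight_family rho (fun N x => a N x * jac x).
Proof.
move=> wa.
have cs (r : R) b : weight_family rho b -> weight_family rho (fun N x => b N x * r).
  move=> wb; apply: (@weight_family_mul _ _ _ (fun _ _ => r)) => //.
    by move=> _; exact: smooth_cst.
  exact: tempered_cst.
have ix b : weight_family rho b -> weight_family rho (fun N x => b N x * x).
  move=> wb; apply: (@weight_family_mul _ _ _ (fun _ x => x)) => //.
    by move=> _; exact: smooth_id.
  exact: tempered_id.
rewrite (_ : (fun N x => _) =
  fun N x => a N x * x * x * (2 * c)^-1 + a N x * (c / 2)).
  apply: weight_family_add; apply: (cs); [do 2! apply: (ix) => //|by []].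
by apply/funext => N; apply/funext => x; rewrite /jac; ring.
Qed.

(** The only place where weak derivatives are used, and each of them is used
    once, against a test function. *)
Lemma pairing_base alpha rho a : measurable_fun setT rho ->
  (forall x, 0 <= rho x) -> weight_family rho a ->
  exists2 C : R, 0 <= C & forall u S, 0 < S -> sobolev_data alpha rho u S ->
  forall N f (B : R), smooth f -> (forall x, `|f x| <= B) ->
  forall k, (k <= alpha)%N ->
  `|\int[mu]_x (u x * derive1n k (fun x => a N x * f x) x)| <= C * B * S.
Proof.
move=> mrho rho0 [sa za ra].
have [C C0 hC] := ra 0%N 1%N.
have W0 : 0 <= \int[mu]_x (1 + x ^+ 2 : R)^-1.
  by apply: Rintegral_ge0 => x _; rewrite invr_ge0 addr_ge0// sqr_ge0.
exists (C * (1 + \int[mu]_x (1 + x ^+ 2)^-1)); first by rewrite mulr_ge0 ?addr_ge0.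
move=> u S S0 [cu hu] N f B sf hf k ka.
have [g [mg hg gS]] := hu k ka.
have B0 : 0 <= B by apply: le_trans (hf 0).
have sp : smooth (fun x => a N x * f x) := smooth_mul (sa N) sf.
rewrite hg; last first.
  by apply: (@test_function_support _ N.+1%:R) => // x h; rewrite za// mul0r.
rewrite normrM normrX normrN1 expr1n mul1r.
rewrite (_ : _ * _ * B * S = (C * B) * S * (1 + \int[mu]_x (1 + x ^+ 2)^-1)); last first.
  by ring.
apply: (@weighted_cauchy_schwarz _ rho g) => //.
- apply: measurable_funM => //.
  exact: (continuous_measurable_fun (smooth_continuous sp)).
- exact: mulr_ge0.
- move=> x; have := hC N x; rewrite expr1 derive1n0 => e.
  rewrite !normrM.
  have -> : (1 + `|x|) * (`|g x| * (`|a N x| * `|f x|)) =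
    ((1 + `|x|) * `|a N x|) * `|f x| * `|g x| by ring.
  have -> : C * B * (`|g x| * Num.sqrt (rho x)) =
    C * Num.sqrt (rho x) * B * `|g x| by ring.
  by rewrite ler_wpM2r// ler_pM//.
Qed.

(** Integration by parts moves the derivatives off the kernel, one at a time:
    a L k' = (a jac k')' - (a jac)' k' with L = jac d/dx. *)
Lemma pairing_bound alpha rho l : measurable_fun setT rho ->
  (forall x, 0 <= rho x) -> forall a, weight_family rho a ->
  forall k, (k + l <= alpha)%N ->
  exists2 C : R, 0 <= C & forall u S, 0 < S -> sobolev_data alpha rho u S ->
  forall N (w : nat -> R -> R) (B : R), (forall j, smooth (w j)) ->
  (forall j x, w j x = jac x * derive1 (w j.+1) x) ->
  (forall x, `|w l x| <= B) ->
  `|\int[mu]_x (u x * derive1n k (fun x => a N x * w 0%N x) x)| <= C * B * S.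
Proof.
move=> mrho rho0; elim: l => [|l IH] a wa k kl.
  have [C C0 hC] := pairing_base alpha mrho rho0 wa; exists C => //.
  move=> u S S0 hu N w B sw _ hB; apply: hC => //.
  by rewrite addn0 in kl.
have wj := weight_family_jac wa; have wd := weight_family_derive wj.
have [|C1 C10 h1] := IH _ wj k.+1; first by rewrite addSnnS.
have [|C2 C20 h2] := IH _ wd k; first by rewrite (leq_trans _ kl)// addnS.
exists (C1 + C2); first exact: addr_ge0.
move=> u S S0 hu N w B sw dw hB; have [cu _] := hu.
have e1 := h1 u S S0 hu N (fun j => w j.+1) B (fun j => sw j.+1) (fun j => dw j.+1) hB.
have e2 := h2 u S S0 hu N (fun j => w j.+1) B (fun j => sw j.+1) (fun j => dw j.+1) hB.
have [sa za _] := wa.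
pose p x := a N x * jac x.
have sp : smooth p by apply: smooth_mul => //; exact: smooth_jac.
have s1 := sw 1%N.
have s2 : smooth (fun x => p x * w 1%N x) := smooth_mul sp s1.
have s3 : smooth (fun x => derive1 p x * w 1%N x).
  exact: (smooth_mul (smooth_derive1 sp) s1).
have zp x : N.+1%:R < `|x| -> p x = 0 by move=> h; rewrite /p za// mul0r.
have split_ : (fun x => a N x * w 0%N x) =
  fun x => derive1 (fun x => p x * w 1%N x) x + (- 1) * (derive1 p x * w 1%N x).
  apply/funext => x; rewrite dw derive1_mul; last 2 first.
  - by move=> y; exact: smooth_derivable.
  - by move=> y; exact: smooth_derivable.
  by rewrite /p; ring.
rewrite split_ derive1n_add; last 2 first.
- exact: smooth_derive1.
- exact: (smooth_mul (@smooth_cst _ (-1)) s3).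
rewrite derive1n_scale// -derive1Sn.
have i1 : integ (fun x => u x * derive1n k.+1 (fun x => p x * w 1%N x) x).
  by apply: (@integ_test _ _ N.+1%:R) => // x h; rewrite zp// mul0r.
have i2 : integ (fun x => u x * derive1n k (fun x => derive1 p x * w 1%N x) x).
  apply: (@integ_test _ _ N.+1%:R) => // x h.
  by have := derive1n_support 1 zp h; rewrite derive1n1 => ->; rewrite mul0r.
under eq_Rintegral => x _ do rewrite mulN1r mulrBr.
rewrite RintegralB//; apply: le_trans (ler_normB _ _) _.
by rewrite !mulrDl lerD.
Qed.

(** By the scaling of wave, the bound of kernel_bounded gains n ^- alpha. The
    integrand on the left is the truncated f rho against the Fejer kernel
    minus 1. *)
Theorem error_against_fejer alpha rho : (0 < alpha)%N -> schwartz_mon rho ->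
  exists2 C : R, 0 <= C & forall u S, 0 < S -> sobolev_data alpha rho u S ->
  forall N M n, (0 < M)%N -> (0 < n)%N ->
  `|\int[mu]_x (u x * (rho x * cutoff N x * pkernel 0 M (n%:R * angle x)))| <=
    C * n%:R ^- alpha * S.
Proof.
move=> a0 hrho; have [[sr _] rho0 _] := hrho.
have mr : measurable_fun setT rho.
  exact: (continuous_measurable_fun (smooth_continuous sr)).
have [|C C0 hC] := @pairing_bound alpha rho alpha mr (fun x => ltW (rho0 x))
  _ (weight_family_cutoff hrho) 0; first by rewrite add0n.
have [B B0 hB] := @kernel_bounded R alpha a0.
exists (C * B); first by rewrite mulr_ge0// ltW.
move=> u S S0 hu N M n M0 n0.
have := hC u S S0 hu N (wave n M) (n%:R ^- alpha * B).
rewrite /= mulrA [C * _ * B]mulrAC.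
under eq_Rintegral => x _ do rewrite /wave expr0 invr1 mul1r.
apply.
- by move=> j; exact: smooth_wave.
- move=> j x; have [_ ->] := is_derive1 (@is_derive_wave n M j x n0).
  by rewrite mulrCA mulfV ?mulr1// gt_eqF// jac_gt0.
- move=> x; rewrite /wave normrM ger0_norm ?invr_ge0 ?exprn_ge0//.
  rewrite ler_wpM2l ?invr_ge0 ?exprn_ge0//.
  by apply: hB => //; rewrite mulr_ge0// angle_ge0.
Qed.

End Pairing.

(** * Fejer means converge to the quadrature rule *)

Section FejerLimit.
Variable R : realType.
Variables (c : R) (c_gt0 : 0 < c).
Implicit Types (f g s v w F : R -> R) (x a b : R).
Notation mu := (@lebesgue_measure R).
Notation integ f := (mu.-integrable setT (EFin \o f)).
Notation seg a b f := (\int[mu]_(x in `[a, b]%classic) f x).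
Notation jac := (jac c).
Notation angle := (angle c).
Notation wave := (wave c).

Lemma seg_integrable a b f : continuous f -> mu.-integrable `[a, b]%classic (EFin \o f).
Proof.
move=> cf; apply: continuous_compact_integrable; first exact: segment_compact.
exact: continuous_subspaceT.
Qed.

Lemma seg_FTC a b F f : a < b -> (forall x, is_derive x 1 F (f x)) ->
  continuous f -> seg a b f = F b - F a.
Proof.
move=> ab dF cf.
have cF : continuous F.
  move=> x; have [h _] := is_derive1 (dF x).
  exact/differentiable_continuous/derivable1_diffP.
rewrite /Rintegral (@continuous_FTC2 _ f F a b)//.
- exact: continuous_subspaceT.
- split.
  + by move=> x _; have [] := is_derive1 (dF x).
  + by apply: cvg_at_right_filter; exact: cF.
  + by apply: cvg_at_left_filter; exact: cF.
- by move=> x _; have [] := is_derive1 (dF x).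
Qed.

Lemma seg_cat a m b f : continuous f -> a <= m -> m <= b ->
  seg a b f = seg a m f + seg m b f.
Proof.
move=> cf am mb.
have i : mu.-integrable [set` Interval (BRight m) (BRight b)] (EFin \o f).
  apply: integrableS (seg_integrable m b cf) => //.
  by apply: subset_itvr; rewrite bnd_simp.
have h1 := @Rintegral_itv_obnd_cbnd _ _ _ _ i.
have h2 := @Rintegral_itvB R f (BLeft a) (BRight b) m (seg_integrable _ _ cf).
rewrite -h1 -h2 ?bnd_simp//.
by rewrite addrC subrK.
Qed.

Lemma seg_norm_le a b f g : continuous f -> continuous g ->
  (forall x, a <= x <= b -> `|f x| <= g x) -> `|seg a b f| <= seg a b g.
Proof.
move=> cf cg h.
have i := seg_integrable a b cf.
apply: le_trans (le_normr_Rintegral _ i) _ => //.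
by apply: le_Rintegral => //; [exact: integrable_norm|exact: seg_integrable].
Qed.

(** Where a continuous w vanishes on the zero set of s, it is dominated by a
    multiple of s up to an arbitrarily small error. *)
Lemma dominated_off_zeros a b w s (e : R) : continuous w -> continuous s ->
  (forall x, 0 <= s x) -> (forall x, a <= x <= b -> s x = 0 -> w x = 0) ->
  0 < e -> exists2 C : R, 0 <= C &
    forall x, a <= x <= b -> w x <= e + C * s x.
Proof.
move=> cw cs s0 sw e0.
pose K : set R := `[a, b]%classic `&` [set x | e <= w x].
have cK : compact K.
  apply: (@subclosed_compact _ _ `[a, b]%classic).
  - apply: closedI; first exact: itv_closed.
    have h : {in ~` (w @^-1` [set y : R | e <= y]), continuous w}.
      by move=> x _; exact: cw.
    exact: (closed_comp h (@closed_ge _ e)).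
  - exact: segment_compact.
  - by move=> x [].
have [K0|K0] := pselect (K !=set0); last first.
  exists 0 => // x xab; rewrite mul0r addr0 leNgt; apply/negP => /ltW h.
  by apply: K0; exists x; split => //=; rewrite in_itv.
have [y yK hy] := compact_EVT_min K0 cK (continuous_subspaceT cs).
have [z zK hz] := compact_EVT_max K0 cK (continuous_subspaceT cw).
have [yab ye] : a <= y <= b /\ e <= w y.
  by move: yK; rewrite inE => -[] /=; rewrite in_itv.
have [zab ze] : a <= z <= b /\ e <= w z.
  by move: zK; rewrite inE => -[] /=; rewrite in_itv.
have sy : 0 < s y.
  rewrite lt_neqAle s0 andbT eq_sym; apply/eqP => /(sw _ yab) wy.
  by move: ye; rewrite wy; lra.
exists (w z / s y); first by rewrite divr_ge0//; lra.
move=> x xab; have [h|h] := leP e (w x); last first.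
  by have := mulr_ge0 (divr_ge0 (_ : 0 <= w z) (ltW sy)) (s0 x); lra.
have xK : x \in K by rewrite inE; split => //=; rewrite in_itv.
have h1 := hz _ xK; have h2 := hy _ xK.
apply: (@le_trans _ _ (w z / s y * s x)); last by rewrite lerDr ltW.
rewrite mulrAC ler_pdivlMr//.
by apply: ler_pM => //; lra.
Qed.

Lemma angle_lt2pi x : angle x < 2 * pi.
Proof. by rewrite /angle; have := atan_ltpi2 (x / c); lra. Qed.

Lemma angle_gt0 x : 0 < angle x.
Proof. by rewrite /angle; have := atan_gtNpi2 (x / c); lra. Qed.

Lemma angle_lt a b : a < b -> angle a < angle b.
Proof.
by move=> ab; rewrite /angle ltrD2l ltr_pM2l// lt_atan// ltr_pM2r// invr_gt0.
Qed.

Lemma angle_le a b : (angle a <= angle b) = (a <= b).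
Proof.
case: (leP a b) => [|ab]; last by apply/negbTE; rewrite -ltNge angle_lt.
by rewrite le_eqVlt => /predU1P[->|/angle_lt/ltW//]; exact: lexx.
Qed.

Lemma angle_inj : injective angle.
Proof. by move=> a b e; apply/eqP; rewrite eq_le -(angle_le a b) -(angle_le b a) e lexx. Qed.

Lemma angle_mobius (t : R) : 0 < t < 2 * pi -> angle (mobius c t) = t.
Proof.
move=> /andP[t0 t1].
have e : mobius c t / c = tan (t / 2 - pi / 2).
  rewrite /mobius /tan sinB cosB sin_pihalf cos_pihalf !mulr0 !mulr1 sub0r add0r.
  by rewrite mulNr mulrC mulrN mulKf ?mulNr// gt_eqF.
rewrite /angle e tanK; first lra.
by rewrite in_itv/=; apply/andP; split; lra.
Qed.

Lemma jac_mobius (t : R) : 0 < t < 2 * pi -> jac (mobius c t) = mobius' c t.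
Proof.
move=> /andP[t0 t1].
have s0 : 0 < sin (t / 2) by apply: sin_gt0_pi; apply/andP; split; lra.
rewrite /jac /mobius /mobius'.
have := cos2Dsin2 (t / 2); move: (sin _) (cos _) s0 => S C s0 e.
have -> : (2 * c)^-1 * (- c * (C / S) * (- c * (C / S))) + c / 2 =
  c / (2 * S ^+ 2) * (C ^+ 2 + S ^+ 2) by field; rewrite !gt_eqF.
by rewrite e mulr1.
Qed.

Lemma cos_eq1_near (u : R) (j : nat) :
  2 * j%:R * pi - pi <= u <= 2 * j%:R * pi + pi -> cos u = 1 -> u = 2 * j%:R * pi.
Proof.
move=> /andP[u1 u2].
have e : (pi *+ 2) *+ j = 2 * j%:R * pi :> R.
  by rewrite -mulrnA -[LHS]mulr_natl natrM.
have {1}-> : u = (u - 2 * j%:R * pi) + (pi *+ 2) *+ j by rewrite e subrK.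
rewrite (periodicn (@cosD2pi R)) -cos_norm => eu.
have : `|u - 2 * j%:R * pi| = 0.
  apply: cos_inj; last by rewrite cos0.
    by rewrite in_itv/= normr_ge0/= ler_norml; apply/andP; split; lra.
  by rewrite in_itv/= lexx pi_ge0.
by move=> /normr0_eq0 /eqP; rewrite subr_eq0 => /eqP.
Qed.

(* The Fejer weight in the variable x, and an antiderivative of it that is
   bounded uniformly in M. *)
Let h n M x : R := fejer M (n%:R * angle x) / jac x.
Let H n M x : R := angle x + wave n M 1 x.

Let is_derive_H n M x : (0 < n)%N -> is_derive x 1 (H n M) (h n M x).
Proof.
move=> n0; rewrite /h /fejer mulrDl mul1r.
have h0 := is_derive_wave c_gt0 M 0 x n0.
have := @is_deriveD _ _ _ _ _ _ _ _ _ (is_derive_angle c_gt0 x) h0.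
by move=> hh; apply: is_derive_eq hh _; rewrite {1}/wave expr0 invr1 mul1r.
Qed.

Let smooth_h n M : smooth (h n M).
Proof.
apply: smooth_mul.
  apply: (@smooth_comp _ (@fejer R M)).
    by apply: smooth_add; [exact: smooth_cst|exact: smooth_kernel].
  by apply: smooth_mul; [exact: smooth_cst|exact: smooth_angle].
apply: smooth_inv; last exact: smooth_jac.
by move=> x; rewrite gt_eqF// jac_gt0.
Qed.

Let h_ge0 n M x : (0 < M)%N -> 0 <= h n M x.
Proof. by move=> M0; rewrite divr_ge0 ?fejer_ge0// ltW// jac_gt0. Qed.

Let H_bound n M x : (0 < n)%N -> (0 < M)%N -> - pi <= H n M x <= 3 * pi.
Proof.
move=> n0 M0.
have hw : `|wave n M 1 x| <= pi.
  rewrite /wave normrM expr1 normfV normr_nat.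
  rewrite ler_pdivrMl ?ltr0n//.
  apply: (@le_trans _ _ pi).
    by apply: kernel1_bound => //; rewrite mulr_ge0// ltW// angle_gt0.
  by rewrite ler_peMl ?pi_ge0// ler1n.
move: hw; rewrite ler_norml /H => /andP[w1 w2].
have := angle_gt0 x; have := angle_lt2pi x.
by move=> a1 a2; apply/andP; split; lra.
Qed.

(** On a piece where v - k vanishes at every node, the Fejer weights, which
    concentrate at the nodes, do not see the difference between v and k. *)
Let piece_cvg0 n a b v (k : R) : (0 < n)%N -> a < b -> continuous v ->
  (forall x, a <= x <= b -> cos (n%:R * angle x) = 1 -> v x = k) ->
  forall e, 0 < e -> exists M0, forall M, (M0 <= M)%N ->
    `|seg a b (fun x => (v x - k) * h n M x)| <= e.
Proof.
move=> n0 ab cv vk e e0.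
pose s x : R := 1 - cos (n%:R * angle x).
have ss : smooth s.
  apply: smooth_add; first exact: smooth_cst.
  apply: smooth_opp; apply: (@smooth_comp _ (@cos R)).
    by have [] := smooth_cos_sin R.
  by apply: smooth_mul; [exact: smooth_cst|exact: smooth_angle].
have s0 x : 0 <= s x by rewrite subr_ge0 cos_le1.
pose w x := `|v x - k|.
have cw : continuous w.
  move=> x; apply: (@continuous_comp _ _ _ (fun x => v x - k) (fun y : R => `|y|)).
    by apply: cvgB; [exact: cv|exact: cvg_cst].
  exact: norm_continuous.
have sw x : a <= x <= b -> s x = 0 -> w x = 0.
  move=> xab /eqP; rewrite subr_eq0 eq_sym => /eqP /(vk _ xab).
  by rewrite /w => ->; rewrite subrr normr0.
have p0 := @pi_gt0 R.
(* The weight h has mass at most 4 pi, hence the share e / (8 pi). *)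
have e1 : 0 < e / (8 * pi) by rewrite divr_gt0 ?mulr_gt0.
have [C C0 hC] := dominated_off_zeros cw (smooth_continuous ss) s0 sw e1.
exists (Num.truncn (8 * pi * C / e)).+1 => M hM.
have M0 : (0 < M)%N by exact: leq_trans hM.
have M0' : (0 : R) < M%:R by rewrite ltr0n.
pose g x := e / (8 * pi) * h n M x + C * (2 / M%:R) * (jac x)^-1.
pose G x := e / (8 * pi) * H n M x + C * (2 / M%:R) * angle x.
have dG x : is_derive x 1 G (g x).
  have g1 := @is_deriveM _ _ _ _ _ _ _ _ (is_derive_cst (e / (8 * pi)) x 1)
    (is_derive_H M x n0).
  have g2 := @is_deriveM _ _ _ _ _ _ _ _ (is_derive_cst (C * (2 / M%:R)) x 1)
    (is_derive_angle c_gt0 x).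
  have := @is_deriveD _ _ _ _ _ _ _ _ _ g1 g2.
  by move=> gg; apply: is_derive_eq gg _; rewrite /GRing.scale/= !mulr0 !addr0.
have cg : continuous g.
  apply: smooth_continuous; apply: smooth_add.
    by apply: smooth_mul; [exact: smooth_cst|exact: smooth_h].
  apply: smooth_mul; first exact: smooth_cst.
  apply: smooth_inv; last exact: smooth_jac.
  by move=> x; rewrite gt_eqF// jac_gt0.
apply: le_trans (@seg_norm_le a b _ g _ cg _) _.
- move=> x; apply: cvgM; last exact/smooth_continuous/smooth_h.
  by apply: cvgB; [exact: cv|exact: cvg_cst].
- move=> x xab; rewrite normrM [`|h _ _ _|]ger0_norm ?h_ge0//.
  apply: le_trans (ler_wpM2r (h_ge0 n x M0) (hC x xab)) _.
  rewrite mulrDl lerD2l -!mulrA ler_wpM2l// /h !mulrA.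
  rewrite ler_wpM2r ?invr_ge0 ?(ltW (jac_gt0 _ _))//.
  exact: fejer_cos.
rewrite (seg_FTC ab dG cg) /G.
have /andP[h1 h2] := H_bound a n0 M0; have /andP[h3 h4] := H_bound b n0 M0.
have a1 := angle_gt0 a; have a2 := angle_lt2pi b.
have b1 : e / (8 * pi) * (H n M b - H n M a) <= e / (8 * pi) * (4 * pi).
  by rewrite ler_wpM2l ?(ltW e1)//; lra.
have b2 : C * (2 / M%:R) * (angle b - angle a) <= C * (2 / M%:R) * (2 * pi).
  by rewrite ler_wpM2l ?mulr_ge0 ?invr_ge0//; lra.
have b3 : e / (8 * pi) * (4 * pi) = e / 2.
  by move: (pi : R) p0 => p p0; field; rewrite gt_eqF.
have b4 : C * (2 / M%:R) * (2 * pi) <= e / 2.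
  have : 8 * pi * C / e < M%:R.
    by apply: lt_le_trans (truncnS_gt _) _; rewrite ler_nat.
  rewrite ltr_pdivrMr// => hh.
  have -> : C * (2 / M%:R) * (2 * pi) = (4 * pi * C) / M%:R.
    by move: (pi : R) => p; field; rewrite gt_eqF.
  by rewrite ler_pdivrMr//; lra.
lra.
Qed.

Let small (T : nat -> R) := forall e : R, 0 < e ->
  exists M0, forall M, (M0 <= M)%N -> `|T M| <= e.

Let small_add T1 T2 : small T1 -> small T2 -> small (fun M => T1 M + T2 M).
Proof.
move=> h1 h2 e e0; have e2 : 0 < e / 2 by rewrite divr_gt0.
have [M1 H1] := h1 _ e2; have [M2 H2] := h2 _ e2.
exists (maxn M1 M2) => M; rewrite geq_max => /andP[m1 m2].
apply: le_trans (ler_normD _ _) _.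
by have := H1 _ m1; have := H2 _ m2; lra.
Qed.

Let small_sum (m : nat) (T : nat -> nat -> R) : (forall j, (j < m)%N -> small (T j)) ->
  small (fun M => \sum_(j < m) T j M).
Proof.
elim: m => [|m IH] hT.
  by move=> e e0; exists 0%N => M _; rewrite big_ord0 normr0 ltW.
move=> e e0.
have [||M0 h0] := @small_add (fun M => \sum_(j < m) T j M) (T m) _ _ e e0.
- by apply: IH => j jm; apply: hT; exact: ltnW.
- exact: hT.
- by exists M0 => M hM; rewrite big_ord_recr; exact: h0.
Qed.

(* The images of the midpoints between consecutive nodes. There the oscillating
   part of the antiderivative H vanishes, so that each cell has for every M
   exactly the mass 2 pi / n of the quadrature rule. *)
Let mid (n j : nat) : R := mobius c ((2 * j%:R + 1) * pi / n%:R).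

Let angle_mid n j : (j < n)%N -> angle (mid n j) = (2 * j%:R + 1) * pi / n%:R.
Proof.
move=> jn; have n0 : (0 : R) < n%:R by rewrite ltr0n (leq_trans _ jn).
have p0 := @pi_gt0 R.
have j0 : (0 : R) <= j%:R by [].
apply: angle_mobius; apply/andP; split.
  by rewrite divr_gt0// mulr_gt0//; lra.
rewrite ltr_pdivrMr// mulrAC ltr_pM2r//.
have : (j%:R + 1 : R) <= n%:R by rewrite natr1 ler_nat.
by lra.
Qed.

Let wave_mid n M j : (j < n)%N -> wave n M 1 (mid n j) = 0.
Proof.
move=> jn; have n0 : (0 : R) < n%:R by rewrite ltr0n (leq_trans _ jn).
rewrite /wave angle_mid// [n%:R * _]mulrCA mulfV ?gt_eqF// mulr1.
by rewrite -natrM natr1 kernel1_node mulr0.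
Qed.

Let node_angle n j : (j.+1 < n)%N -> angle (mobius c (node R n j.+1)) = 2 * pi * j.+1%:R / n%:R.
Proof.
move=> jn; have n0 : (0 : R) < n%:R by rewrite ltr0n (leq_trans _ jn).
have p0 := @pi_gt0 R.
apply: angle_mobius; rewrite /node; apply/andP; split.
  by rewrite divr_gt0// !mulr_gt0.
by rewrite ltr_pdivrMr// ltr_pM2l ?mulr_gt0// ltr_nat.
Qed.

Let at_node n j x : (j.+1 < n)%N -> mid n j <= x <= mid n j.+1 ->
  cos (n%:R * angle x) = 1 -> x = mobius c (node R n j.+1).
Proof.
move=> jn /andP[x1 x2] hc.
have n0 : (0 : R) < n%:R by rewrite ltr0n (leq_trans _ jn).
have p0 := @pi_gt0 R.
apply: angle_inj; rewrite node_angle//.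
move: x1 x2; rewrite -angle_le -[x <= _]angle_le !angle_mid ?(ltnW jn)//.
rewrite ler_pdivrMr// ler_pdivlMr// [angle x * _]mulrC => x1 x2.
apply: (mulfI (lt0r_neq0 n0)).
have -> : n%:R * angle x = 2 * j.+1%:R * pi; last first.
  by rewrite mulrCA mulfV ?gt_eqF// mulr1 mulrAC.
apply: cos_eq1_near => //; move: x1 x2; rewrite -(natr1 j) => x1 x2.
by apply/andP; split; lra.
Qed.

Let seg_h n M a b : (0 < n)%N -> a < b -> seg a b (h n M) = H n M b - H n M a.
Proof.
move=> n0 ab; apply: (@seg_FTC a b (H n M) (h n M) ab).
  by move=> x; exact: is_derive_H.
exact: (smooth_continuous (@smooth_h n M)).
Qed.

Let seg_split n M a b v (k : R) : continuous v ->
  seg a b (fun x => v x * h n M x) =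
  seg a b (fun x => (v x - k) * h n M x) + k * seg a b (h n M).
Proof.
move=> cv; have ch := smooth_continuous (@smooth_h n M).
have i1 : continuous (fun x => (v x - k) * h n M x).
  move=> x; apply: cvgM; last exact: ch.
  by apply: cvgB; [exact: cv|exact: cvg_cst].
have i2 : continuous (fun x => k * h n M x).
  by move=> x; apply: cvgM; [exact: cvg_cst|exact: ch].
rewrite -RintegralZl//; last exact: seg_integrable.
rewrite -RintegralD//; try exact: seg_integrable.
by apply: eq_Rintegral => x _; rewrite mulrBl subrK.
Qed.

(** The support of v0 is cut at the midpoints. The cell of a node gives the value
    of v0 * jac there times the mass of the cell, and the two end pieces, which
    contain no node, give 0. *)
Theorem fejer_limit m v0 (A e : R) : continuous v0 ->
  (forall x, A < `|x| -> v0 x = 0) -> 0 < e ->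
  exists2 M, (0 < M)%N &
  `|\int[mu]_x (v0 x * fejer M (m.+1%:R * angle x)) -
    2 * pi / m.+1%:R * \sum_(j < m)
      (v0 (mobius c (node R m.+1 j.+1)) * jac (mobius c (node R m.+1 j.+1)))|
  <= e.
Proof.
move=> cv0 z0 e0; pose n := m.+1.
have n0 : (0 : R) < n%:R by [].
have p0 := @pi_gt0 R.
pose v x := v0 x * jac x.
have cv : continuous v.
  by move=> x; apply: cvgM; [exact: cv0|exact/smooth_continuous/smooth_jac].
have mid_lt j : (j < m)%N -> mid n j < mid n j.+1.
  move=> jm; rewrite ltNge -angle_le !angle_mid// ?ltnS ?(ltnW jm)// -ltNge.
  by rewrite ltr_pM2r ?invr_gt0// ltr_pM2r// -(natr1 j); lra.
pose A' := `|A| + `|mid n 0| + `|mid n m| + 1.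
have lo : - A' < mid n 0.
  rewrite ltrNl /A'; have := ler_norm (- mid n 0); rewrite normrN => h1.
  have := normr_ge0 A; have := normr_ge0 (mid n m); lra.
have hi : mid n m < A'.
  rewrite /A'; have h1 := ler_norm (mid n m).
  have := normr_ge0 A; have := normr_ge0 (mid n 0); lra.
pose xj j := mobius c (node R n j.+1).
have mass j M : (j < m)%N -> seg (mid n j) (mid n j.+1) (h n M) = 2 * pi / n%:R.
  move=> jm; rewrite seg_h ?mid_lt// /H !wave_mid ?angle_mid ?ltnS ?(ltnW jm)//.
  by rewrite !addr0 -mulrBl -mulrBl -(natr1 j); congr (_ * _ / _); ring.
pose T0 M := seg (- A') (mid n 0) (fun x => (v x - 0) * h n M x).
pose T1 M := seg (mid n m) A' (fun x => (v x - 0) * h n M x).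
pose T j M := seg (mid n j) (mid n j.+1) (fun x => (v x - v (xj j)) * h n M x).
have s0 : small T0.
  apply: piece_cvg0 => // x /andP[_ x2] hc; exfalso.
  move: x2; rewrite -angle_le angle_mid// ler_pdivlMr// mulrC => x2.
  have a0 : 0 < n%:R * angle x by rewrite mulr_gt0// angle_gt0.
  have := @cos_eq1_near (n%:R * angle x) 0; rewrite mulr0 mul0r => /(_ _ hc) hh.
  have := a0; rewrite hh ?ltxx//; apply/andP; split; lra.
have s1 : small T1.
  apply: piece_cvg0 => // x /andP[x1 _] hc; exfalso.
  move: x1; rewrite -angle_le angle_mid// ler_pdivrMr// mulrC => x1.
  have a0 : n%:R * angle x < n%:R * (2 * pi) by rewrite ltr_pM2l// angle_lt2pi.
  have nm : (n%:R : R) = m%:R + 1 by rewrite natr1.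
  have := @cos_eq1_near (n%:R * angle x) n => /(_ _ hc) hh.
  have := a0; rewrite [in ltLHS]hh; first by rewrite mulrCA mulrA ltxx.
  by apply/andP; move: x1 a0; rewrite nm => x1 a0; split; lra.
have sT j : (j < m)%N -> small (T j).
  move=> jm; apply: piece_cvg0 => //; first exact: mid_lt.
  by move=> x hx hc; rewrite (at_node _ hx hc).
have [M0 hM0] := small_add s0 (small_add s1 (small_sum sT)) e0.
exists M0.+1 => //; have := hM0 M0.+1 (leqnSn _); set M := M0.+1.
suff -> : \int[mu]_x (v0 x * fejer M (m.+1%:R * angle x)) -
    2 * pi / m.+1%:R * \sum_(j < m) (v0 (xj j) * jac (xj j)) =
    T0 M + (T1 M + \sum_(j < m) T j M) by [].
have cvh : continuous (fun x => v x * h n M x).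
  by move=> x; apply: cvgM; [exact: cv|exact/smooth_continuous/smooth_h].
have -> : \int[mu]_x (v0 x * fejer M (m.+1%:R * angle x)) =
    seg (- A') A' (fun x => v x * h n M x).
  rewrite [RHS]Rintegral_mkcond; apply: eq_Rintegral => x _.
  rewrite patchE; case: ifPn => [_|].
    by rewrite /v /h; field; rewrite gt_eqF// jac_gt0.
  rewrite notin_setE/= in_itv/= -ler_norml => /negP; rewrite -ltNge => xA.
  rewrite z0 ?mul0r//; apply: le_lt_trans xA; rewrite /A'.
  have := ler_norm A; have := normr_ge0 (mid n m); have := normr_ge0 (mid n 0); lra.
have mid0 k : (k <= m)%N -> mid n 0 <= mid n k /\
    seg (mid n 0) (mid n k) (fun x => v x * h n M x) =
    \sum_(j < k) seg (mid n j) (mid n j.+1) (fun x => v x * h n M x).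
  elim: k => [_|k IH km]; first by rewrite big_ord0 set_itv1 Rintegral_set1.
  have [i1 i2] := IH (ltnW km); have i3 := ltW (mid_lt k km).
  split; first exact: le_trans i3.
  by rewrite (seg_cat cvh i1 i3) i2 big_ord_recr.
have [m1 m2] := mid0 m (leqnn m).
rewrite (@seg_cat _ (mid n 0))//; last 2 first.
- exact: ltW.
- exact: le_trans m1 (ltW hi).
rewrite (@seg_cat _ (mid n m) A')//; last exact: ltW.
rewrite m2 (seg_split _ _ _ _ 0)// mul0r addr0 -/(T0 M).
rewrite (seg_split _ _ (mid n m) _ 0)// mul0r addr0 -/(T1 M).
have -> : \sum_(j < m) seg (mid n j) (mid n j.+1) (fun x => v x * h n M x) =
    \sum_(j < m) T j M + 2 * pi / n%:R * \sum_(j < m) v (xj j).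
  rewrite mulr_sumr -big_split/=; apply: eq_bigr => j _.
  by rewrite (seg_split _ _ _ _ (v (xj j)))// mass//; congr (_ + _); rewrite mulrC.
rewrite /v -/n; ring.
Qed.

End FejerLimit.

(** * The estimate for real functions *)

Section RealEstimate.
Variable R : realType.
Variables (c : R) (c_gt0 : 0 < c).
Implicit Types (f g rho u v : R -> R) (x : R).
Notation mu := (@lebesgue_measure R).
Notation integ f := (mu.-integrable setT (EFin \o f)).

Lemma cutoff_itv N x : 0 <= cutoff N x <= 1.
Proof. exact: chi_itv. Qed.

Lemma cutoff_cvg x : cutoff N x @[N --> \oo] --> (1 : R).
Proof.
have c0 : (@chi R) y @[y --> (0 : R)] --> (@chi R) 0.
  exact: smooth_continuous (@smooth_chi R) 0.
have l : (N.+1%:R^-1 * x : R) @[N --> \oo] --> (0 : R).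
  rewrite -[X in _ --> X](mul0r x); apply: cvgM; last exact: cvg_cst.
  exact: cvg_harmonic.
by have := cvg_comp _ _ l c0; rewrite chi0.
Qed.

Lemma integ_weight rho : schwartz_mon rho -> integ rho.
Proof.
move=> hrho; have [[sr dr] rho0 _] := hrho.
have [C0 h0] := dr 0%N 0%N; have [C2 h2] := dr 2%N 0%N.
apply: (@integ_dom _ _ (fun x => (C0 + C2) * (1 + x ^+ 2)^-1)).
- exact: (continuous_measurable_fun (smooth_continuous sr)).
- move=> x; have q0 : 0 < 1 + x ^+ 2 by rewrite ltr_pwDl// sqr_ge0.
  rewrite ler_pdivlMr// mulrDr mulr1; apply: lerD.
    by have := h0 _ (imageT _ x); rewrite expr0 mul1r.
  have := h2 _ (imageT _ x).
  by rewrite normrM [`|x ^+ 2|]ger0_norm ?sqr_ge0// mulrC.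
- exact/integ_scale/integ_oneDsqr.
Qed.

Lemma integ_weighted rho u (S : R) : schwartz_mon rho -> continuous u ->
  (\int[mu]_x (u x ^+ 2 * rho x)%:E <= (S ^+ 2)%:E)%E ->
  integ (fun x => u x * rho x).
Proof.
move=> hrho cu hS; have [[sr dr] rho0 _] := hrho.
have mu_ := continuous_measurable_fun cu.
have mr := continuous_measurable_fun (smooth_continuous sr).
have [||iu _] := integ_of_integral_le _ _ hS.
- by apply: measurable_funM => //; exact: measurable_funX.
- by move=> x; rewrite mulr_ge0 ?sqr_ge0// ltW.
apply: (integ_dom _ _ (integ_add iu (integ_weight hrho))).
  exact: measurable_funM.
move=> x; rewrite normrM (gtr0_norm (rho0 x)) -[X in _ + X]mul1r -mulrDl.
rewrite ler_wpM2r ?(ltW (rho0 x))// -[u x ^+ 2]ger0_norm ?sqr_ge0// normrX.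
by have := sqr_ge0 (`|u x| - 1); nra.
Qed.

Definition nodes_sum (v : R -> R) (m : nat) : R :=
  2 * pi / m.+1%:R * \sum_(j < m)
    (v (mobius c (node R m.+1 j.+1)) * jac c (mobius c (node R m.+1 j.+1))).

(** With the cutoff fixed, fejer_limit turns the Fejer kernel into the nodes of
    the rule. As the bound is the same for all cutoffs, it passes to the limit. *)
Theorem real_quadrature_error alpha rho : (0 < alpha)%N -> schwartz_mon rho ->
  exists2 C : R, 0 <= C & forall u S, 0 < S -> sobolev_data alpha rho u S ->
  (\int[mu]_x (u x ^+ 2 * rho x)%:E <= (S ^+ 2)%:E)%E ->
  forall m, `|\int[mu]_x (u x * rho x) - nodes_sum (fun x => u x * rho x) m| <=
    C * m.+1%:R ^- alpha * S.
Proof.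
move=> a0 hrho; have [C C0 hC] := error_against_fejer c_gt0 a0 hrho.
have [[sr dr] rho0 _] := hrho.
exists C => // u S S0 hu hS m; have [cu _] := hu.
have cr := smooth_continuous sr.
pose w N x := u x * (rho x * cutoff N x).
have cw N : continuous (w N).
  move=> x; apply: cvgM; first exact: cu.
  by apply: cvgM; [exact: cr|exact/smooth_continuous/smooth_cutoff].
have zw N x : N.+1%:R < `|x| -> w N x = 0.
  by move=> h; rewrite /w cutoff_out// !mulr0.
have truncated N : `|\int[mu]_x w N x - nodes_sum (w N) m| <= C * m.+1%:R ^- alpha * S.
  apply/ler_addgt0Pr => e e0.
  have [M M0 hM] := fejer_limit c_gt0 m (cw N) (@zw N) e0.
  have hk := hC u S S0 hu N M m.+1 M0 (ltn0Sn m).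
  have i1 : integ (w N) by apply: integ_compact_support; [exact: cw|exact: zw].
  have sk : smooth (fun x => pkernel 0 M (m.+1%:R * angle c x)).
    apply: (@smooth_comp _ (@pkernel R 0 M)); first exact: smooth_kernel.
    by apply: smooth_mul; [exact: smooth_cst|exact: smooth_angle].
  have i2 : integ (fun x => w N x * pkernel 0 M (m.+1%:R * angle c x)).
    apply: (@integ_compact_support _ _ N.+1%:R).
      by move=> x; apply: cvgM; [exact: cw|exact: (smooth_continuous sk)].
    by move=> x h; rewrite zw// mul0r.
  have e1 : \int[mu]_x (w N x * fejer M (m.+1%:R * angle c x)) =
      \int[mu]_x w N x + \int[mu]_x (w N x * pkernel 0 M (m.+1%:R * angle c x)).
    rewrite -RintegralD//; apply: eq_Rintegral => x _.
    by rewrite /fejer mulrDr mulr1.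
  have e2 : \int[mu]_x (w N x * pkernel 0 M (m.+1%:R * angle c x)) =
    \int[mu]_x (u x * (rho x * cutoff N x * pkernel 0 M (m.+1%:R * angle c x))).
    by apply: eq_Rintegral => x _; rewrite /w !mulrA.
  rewrite e1 -/(nodes_sum (w N) m) e2 in hM.
  move: hM hk; set I := \int[mu]_x w N x; set J := \int[mu]_x (_ * _).
  set Q := nodes_sum _ _ => hM hk.
  have -> : I - Q = (I + J - Q) - J by ring.
  by apply: le_trans (ler_normB _ _) _; rewrite addrC lerD.
have iw := integ_weighted hrho cu hS.
have w_cvg x : w N x @[N --> \oo] --> u x * rho x.
  rewrite -[X in _ --> X]mulr1 -mulrA; apply: cvgM; first exact: cvg_cst.
  by apply: cvgM; [exact: cvg_cst|exact: cutoff_cvg].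
have limI : \int[mu]_x w N x @[N --> \oo] --> \int[mu]_x (u x * rho x).
  have [|||||_ _] := @dominated_convergence _ _ R mu setT measurableT
    (fun N => EFin \o w N) (EFin \o (fun x => u x * rho x))
    (EFin \o (fun x => `|u x * rho x|)).
  - by move=> N; apply/measurable_EFinP; exact: (continuous_measurable_fun (cw N)).
  - have cur : continuous (fun x => u x * rho x).
      by move=> x; apply: cvgM; [exact: cu|exact: cr].
    by apply/measurable_EFinP; exact: (continuous_measurable_fun cur).
  - by apply: aeW => x _; apply: cvg_EFin; [near=> N|exact: w_cvg].
  - exact: integrable_norm.
  - apply: aeW => x N _ /=; rewrite lee_fin /w mulrA normrM.
    have /andP[c0 c1] := cutoff_itv N x.
    by rewrite [`|cutoff _ _|]ger0_norm// ler_piMr.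
  rewrite -[X in _ --> X](@fineK) ; last exact: integrable_fin_num.
  by move=> /fine_cvg.
have limQ : nodes_sum (w N) m @[N --> \oo] --> nodes_sum (fun x => u x * rho x) m.
  rewrite /nodes_sum; apply: cvgM; first exact: cvg_cst.
  apply: (@cvg_big _ _ +%R) => [|j _]; first exact: add_continuous.
  by apply: cvgM; [exact: w_cvg|exact: cvg_cst].
have lim := cvg_norm (cvgB limI limQ).
apply: (cvgr_to_le (lim _ _)); by apply: nearW => N; exact: truncated.
Unshelve. all: by end_near. Qed.

End RealEstimate.

(** * Complex-valued functions *)

Section ComplexValued.
Variable R : realType.
Implicit Types (rho : R -> R) (f g : R -> R[i]) (x : R) (z : R[i]).
Notation mu := (@lebesgue_measure R).

(** One name for the real and the imaginary part, so that both are treated by the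
    same lemmas. *)
Definition part (b : bool) z : R := if b then complex.Im z else complex.Re z.

Lemma normc_le_parts z : Normc.normc z <= `|part false z| + `|part true z|.
Proof.
case: z => a b /=; rewrite -[leRHS]ger0_norm ?addr_ge0// -sqrtr_sqr.
rewrite ler_wsqrtr// sqrrD !real_normK ?num_real//.
by rewrite lerD2r lerDl mulrn_wge0// mulr_ge0.
Qed.

Lemma part_le_normc b z : `|part b z| <= Normc.normc z.
Proof.
by case: b z => -[a d] /=; rewrite -sqrtr_sqr ler_wsqrtr// ?lerDl ?lerDr sqr_ge0.
Qed.

Lemma partD b z1 z2 : part b (z1 + z2) = part b z1 + part b z2.
Proof. by case: b z1 z2 => -[? ?] [? ?]. Qed.

Lemma partN b z : part b (- z) = - part b z.
Proof. by case: b z => -[? ?]. Qed.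

Lemma partMr b z (r : R) : part b (z * r%:C%C) = part b z * r.
Proof. by case: b z => -[x y] /=; rewrite mulr0 ?subr0 ?add0r. Qed.

Lemma partMl b z (r : R) : part b (r%:C%C * z) = r * part b z.
Proof. by rewrite mulrC partMr mulrC. Qed.

Lemma part_sum b (n : nat) (F : 'I_n -> R[i]) :
  part b (\sum_(j < n) F j) = \sum_(j < n) part b (F j).
Proof. by apply: (big_morph (part b)); [exact: partD|case: b]. Qed.

Lemma part_cintegral b f : part b (cintegral f) = \int[mu]_x part b (f x).
Proof. by case: b. Qed.

Lemma continuous_part b f : continuous (f : R -> (R[i])^o) ->
  continuous (fun x => part b (f x)).
Proof.
move=> cf x; apply/cvgrPdist_lt => e e0.
have e0' : (0 : R[i]) < e%:C%C by rewrite ltcR.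
have /cvgrPdist_lt /(_ _ e0') := cf x.
apply: filterS => y; rewrite /= normc_def => h.
have : Normc.normc (f x - f y) < e.
  rewrite -ltcR; apply: le_lt_trans h.
  by case: (f x - f y).
by apply: le_lt_trans; rewrite -partN -partD; exact: part_le_normc.
Qed.

Lemma measurable_part b f : clocally_integrable f ->
  measurable_fun setT (fun x => part b (f x)).
Proof. by move=> [[mr _ _] [mi _ _]]; case: b. Qed.

Lemma weak_derivP alpha rho f k : sobolev alpha 2 rho f -> (k <= alpha)%N ->
  is_weak_deriv k f (weak_deriv f k).
Proof.
move=> [hw _] ka; case: k ka => [|k] ka.
  have [g [lf _ _]] := hw 0%N ka; split=> // psi _.
  by rewrite expr0 mul1r.
exact: (xgetPex (fun _ : R => 0 : R[i]) (hw _ ka)).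
Qed.

Lemma measurable_normc_sq rho f : measurable_fun setT rho ->
  clocally_integrable f ->
  measurable_fun setT (fun x => (powR (Normc.normc (f x)) 2 * rho x)).
Proof.
move=> mr lf.
have e : (fun x => powR (Normc.normc (f x)) 2 * rho x) =
    fun x => (part false (f x) ^+ 2 + part true (f x) ^+ 2) * rho x.
  apply/funext => x; rewrite powR_mulrn; last first.
    by case: (f x) => a b /=; exact: sqrtr_ge0.
  by case: (f x) => a b /=; rewrite sqr_sqrtr// addr_ge0 ?sqr_ge0.
rewrite e; apply: measurable_funM => //.
by apply: measurable_funD; apply: measurable_funX; exact: measurable_part.
Qed.

Lemma sobolev_norm_term alpha rho f k : measurable_fun setT rho ->
  (forall x, 0 <= rho x) -> sobolev alpha 2 rho f -> (k <= alpha)%N ->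
  forall b, (\int[mu]_x (part b (weak_deriv f k x) ^+ 2 * rho x)%:E <=
    (fine (sobolev_norm alpha 2 rho f) ^+ 2)%:E)%E.
Proof.
move=> mr rho0 hf ka b; have [lf lg _] := weak_derivP hf ka.
have [_] := hf; rewrite /sobolev_norm.
set T := (\sum_(0 <= tau < alpha.+1) _)%E => Tfin.
have term0 tau : (0 <= \int[mu]_x
    (powR (Normc.normc (weak_deriv f tau x)) 2 * rho x)%:E)%E.
  by apply: integral_ge0 => x _; rewrite lee_fin mulr_ge0// powR_ge0.
have T0 : (0 <= T)%E by apply: sume_ge0 => tau _; exact: term0.
have -> : ((fine (T `^ 2^-1) ^+ 2)%:E = T)%E.
  move: T T0 Tfin => [r| |]//=; last by rewrite invr_eq0 pnatr_eq0/= ltxx.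
  rewrite lee_fin => r0 _; rewrite powR12_sqrt// sqr_sqrtr//.
apply: (@le_trans _ _ (\int[mu]_x
    (powR (Normc.normc (weak_deriv f k x)) 2 * rho x)%:E)%E).
  apply: ge0_le_integral => //.
  - by move=> x _; rewrite lee_fin mulr_ge0// sqr_ge0.
  - apply/measurable_EFinP; apply: measurable_funM => //.
    by apply: measurable_funX; exact: measurable_part.
  - by apply/measurable_EFinP; exact: measurable_normc_sq.
  - move=> x _; rewrite lee_fin ler_wpM2r// powR_mulrn; last first.
      by case: (weak_deriv f k x) => a d /=; exact: sqrtr_ge0.
    rewrite -[leLHS]ger0_norm ?sqr_ge0// normrX.
    by rewrite lerXn2r ?nnegrE// ?(le_trans _ (part_le_normc b _))// part_le_normc.
rewrite /T big_mkord (bigD1 (Ordinal (ka : (k < alpha.+1)%N)))//=.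
by rewrite leeDl// sume_ge0.
Qed.

Lemma sobolev_data_part alpha rho f b (S : R) :
  measurable_fun setT rho -> (forall x, 0 <= rho x) ->
  continuous (f : R -> (R[i])^o) -> sobolev alpha 2 rho f ->
  fine (sobolev_norm alpha 2 rho f) <= S ->
  sobolev_data alpha rho (fun x => part b (f x)) S /\
  (\int[mu]_x (part b (f x) ^+ 2 * rho x)%:E <= (S ^+ 2)%:E)%E.
Proof.
move=> mr rho0 cf hf hS.
have S2 : ((fine (sobolev_norm alpha 2 rho f) ^+ 2)%:E <= (S ^+ 2)%:E)%E.
  have n0 : 0 <= fine (sobolev_norm alpha 2 rho f) by rewrite fine_ge0// poweR_ge0.
  by rewrite lee_fin lerXn2r// nnegrE (le_trans n0).
split; last first.
  exact: le_trans (@sobolev_norm_term _ _ _ 0%N mr rho0 hf (leq0n _) b) S2.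
split; first exact: continuous_part.
move=> k ka; exists (fun x => part b (weak_deriv f k x)).
have [lf lg hw] := weak_derivP hf ka; split.
- exact: measurable_part.
- move=> psi tpsi; have := congr1 (part b) (hw psi tpsi).
  rewrite (_ : (-1) ^+ k = ((-1) ^+ k : R)%:C%C); last first.
    by rewrite rmorphXn/= rmorphN1.
  rewrite partMl !part_cintegral.
  under eq_Rintegral => x _ do rewrite partMr.
  by under [X in _ * X]eq_Rintegral => x _ do rewrite partMr.
- exact: le_trans (sobolev_norm_term mr rho0 hf ka b) S2.
Qed.

Lemma part_quadrature (c : R) (c_gt0 : 0 < c) rho f b m :
  part b (quadrature c rho m.+1 f) =
  nodes_sum c (fun x => part b (f x) * rho x) m.
Proof.
rewrite /quadrature /nodes_sum partMl; congr (_ * _).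
rewrite big_add1 big_mkord part_sum big_ord_recr/= eqxx.
have -> : part b 0 = 0 by case: b.
rewrite addr0; apply: eq_bigr => j _.
rewrite ltn_eqF ?ltnS// partMr jac_mobius ?mulrA//.
have p0 := @pi_gt0 R; have m0 : (0 : R) < m.+1%:R by [].
rewrite /node; apply/andP; split; first by rewrite divr_gt0// !mulr_gt0.
by rewrite ltr_pdivrMr// ltr_pM2l ?mulr_gt0// ltr_nat ltnS.
Qed.

End ComplexValued.

Theorem theorem3p1 (R : realType) (c : R) (c_gt0 : 0 < c)
    (alpha : nat) (alpha_gt0 : (0 < alpha)%N)
    (rho : R -> R) (rho_mon : schwartz_mon rho) :
  exists C : R, 0 < C /\
    forall f : R -> R[i],
      continuous (f : R -> (R[i])^o) ->
      sobolev alpha 2 rho f ->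
      forall n : nat, (0 < n)%N ->
        Normc.normc (weighted_integral rho f - quadrature c rho n f) <=
          C * n%:R ^- alpha * fine (sobolev_norm alpha 2 rho f).
Proof.
have [C C0 hC] := real_quadrature_error c_gt0 alpha_gt0 rho_mon.
have [[sr _] rho0 _] := rho_mon.
have mr := continuous_measurable_fun (smooth_continuous sr).
exists (2 * C + 1); split; first by lra.
move=> f cf hf [//|m] _.
set S := fine _.
have S0 : 0 <= S by rewrite fine_ge0// poweR_ge0.
have q0 : 0 < m.+1%:R ^- alpha :> R by rewrite invr_gt0 exprn_gt0.
have bound b : `|part b (weighted_integral rho f - quadrature c rho m.+1 f)| <=
    C * m.+1%:R ^- alpha * S.
  apply/ler_addgt0Pr => e e0.
  pose d := e / (C * m.+1%:R ^- alpha + 1).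
  have p0 : 0 <= C * m.+1%:R ^- alpha by rewrite mulr_ge0// ltW.
  have d0 : 0 < d by rewrite divr_gt0//; lra.
  have Sd : S <= S + d by lra.
  have Sd0 : 0 < S + d by lra.
  have [hu hu2] := sobolev_data_part b mr (fun x => ltW (rho0 x)) cf hf Sd.
  have := hC _ _ Sd0 hu hu2 m.
  rewrite partD partN part_quadrature// part_cintegral.
  under eq_Rintegral => x _ do rewrite -partMr.
  move=> h; apply: le_trans h _; rewrite mulrDr lerD2l /d mulrA ler_pdivrMr; last lra.
  by rewrite [leRHS]mulrC ler_wpM2r ?(ltW e0)//; lra.
apply: le_trans (normc_le_parts _) _.
apply: le_trans (lerD (bound false) (bound true)) _.
have : 0 <= m.+1%:R ^- alpha * S by rewrite mulr_ge0// ltW.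
by rewrite -!mulrA; move: (_ * S) => t t0; lra.
Qed.
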